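(* Let $p(\cdot)\in\mathcal{P}(\mathbb{R}^d)$ and let $q,\alpha$ be constants with $1\le q\le\alpha\le p(\cdot)$. Then the space $\mathcal{H}(p(\cdot),q,\alpha)$ is separable.
   Context: $\mathcal{P}(\mathbb{R}^d)$ is the set of measurable $p(\cdot):\mathbb{R}^d\to[1,\infty]$ with $1<p_-\le p(\cdot)\le p_+<\infty$, where $p_-$ and $p_+$ are the essential infimum and supremum. $\|f\|_{p(\cdot)}=\inf\{\lambda>0:\int_{\mathbb{R}^d}(|f(x)|/\lambda)^{p(x)}dx\le1\}$; $L^{p(\cdot)}$ is the set of measurable complex-valued $f$ with $\|f\|_{p(\cdot)}<\infty$; $L^{p(\cdot)}_{\rm loc}$ is the set of measurable $f$ with $f\chi_K\in L^{p(\cdot)}$ for every compact $K$. For $k\in\mathbb{Z}^d$, $r>0$, $I_k^r=\prod_{j=1}^d[rk_j,r(k_j+1))$. $\|f\|_{p(\cdot),q}=\big\|\{\|f\chi_{I_k^1}\|_{p(\cdot)}\}_{k\in\mathbb{Z}^d}\big\|_{\ell^q}$ and $(L^{p(\cdot)},\ell^q)=\{f\in L^{p(\cdot)}_{\rm loc}:\|f\|_{p(\cdot),q}<\infty\}$. For $\rho>0$, $St_\rho^{(\alpha)}f(x)=\rho^{-d/\alpha}f(\rho^{-1}x)$. An $\mathfrak{h}$-decomposition of $f\in L^{p(\cdot)}_{\rm loc}$ is a sequence $\{(c_n,\rho_n,f_n)\}_{n\ge1}$ in $\mathbb{C}\times(0,\infty)\times(L^{p(\cdot)},\ell^q)$ with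 $\|f_n\|_{p(\cdot),q}\le1$ for all $n$, $\sum_{n\ge1}|c_n|<\infty$, and $f=\sum_{n\ge1}c_nSt_{\rho_n}^{(\alpha)}f_n$ in the sense of $L^{p(\cdot)}_{\rm loc}$. $\mathcal{H}(p(\cdot),q,\alpha)$ is the set of $f\in L^{p(\cdot)}_{\rm loc}$ having at least one $\mathfrak{h}$-decomposition. $\sigma_{p(\cdot),q,\alpha}(f)$ is the infimum of $\sum_{n\ge1}|c_n|$ over all $\mathfrak{h}$-decompositions of $f$ ($\infty$ if there are none), and the norm of $\mathcal{H}(p(\cdot),q,\alpha)$ is $\|f\|_{\mathcal{H}(p(\cdot),q,\alpha)}=\sigma_{p(\cdot),q,\alpha}(|f|)$. *)

(* Defs.v *)
From HB Require Import structures.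
From mathcomp Require Import all_boot all_order all_algebra.
From mathcomp Require Import all_classical all_reals all_analysis.
From mathcomp Require Import measurable_realfun ess_sup_inf complex.

Set Implicit Arguments.
Unset Strict Implicit.
Unset Printing Implicit Defensive.
Import Order.TTheory GRing.Theory Num.Theory.
Import numFieldNormedType.Exports.

Local Open Scope classical_set_scope.
Local Open Scope ring_scope.

(* The Euclidean space of dimension d >= 1 is 'rV[R]_n.+1, with d = n.+1. *)

Section lebesgue_outer_measure.
Variables (R : realType) (n : nat).
Implicit Types (Q : 'rV[R]_n.+1 * 'rV[R]_n.+1) (A : set 'rV[R]_n.+1).

Definition box Q : set 'rV[R]_n.+1 :=
  [set x | forall j, Q.1 ord0 j <= x ord0 j < Q.2 ord0 j].

Definition box_volume Q : R :=
  \prod_(j < n.+1) Num.max 0 (Q.2 ord0 j - Q.1 ord0 j).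

Definition lebesgue_outer A : \bar R :=
  ereal_inf [set (\sum_(0 <= k <oo) (box_volume (Q k))%:E)%E
            | Q in [set Q : nat -> 'rV[R]_n.+1 * 'rV[R]_n.+1
                   | A `<=` \bigcup_k box (Q k)]].

Local Open Scope ereal_scope.

Lemma box_volume_ge0 Q : 0 <= (box_volume Q)%:E.
Proof. by rewrite lee_fin prodr_ge0// => j _; rewrite le_max lexx. Qed.

Lemma lebesgue_outer_ge0 A : 0 <= lebesgue_outer A.
Proof.
apply: le_ereal_inf_tmp => _ [Q AQ <-].
by apply: nneseries_ge0 => k _ _; exact: box_volume_ge0.
Qed.

Lemma le_lebesgue_outer : {homo lebesgue_outer : A B / A `<=` B >-> A <= B}.
Proof.
move=> A B AB; apply/ereal_inf_le_tmp => _ [Q BQ <-].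
by exists Q => //; exact: subset_trans BQ.
Qed.

Lemma lebesgue_outer0 : lebesgue_outer set0 = 0.
Proof.
apply/eqP; rewrite eq_le lebesgue_outer_ge0 andbT.
apply: ereal_inf_lbound; exists (fun=> (0%R, 0%R)) => //.
rewrite eseries0// => k _ _; congr (_%:E).
by rewrite /box_volume big_ord_recl/= subrr maxxx mul0r.
Qed.

Lemma lebesgue_outer_sigma_subadditive : sigma_subadditive lebesgue_outer.
Proof.
move=> A; have [[i ioo]|] := pselect (exists i, lebesgue_outer (A i) = +oo).
  rewrite (eseries_pinfty _ _ ioo) ?leey// => k _.
  by rewrite -ltNye (lt_le_trans _ (lebesgue_outer_ge0 _)).
rewrite -forallNE => Aoo.
suff add2e (e : {posnum R}) : lebesgue_outer (\bigcup_n A n) <=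
    \sum_(i <oo) lebesgue_outer (A i) + e%:num%:E.
  by apply/lee_addgt0Pr => _/posnumP[].
rewrite (le_trans _ (epsilon_trick _ _ _))//; last first.
  by move=> k; exact: lebesgue_outer_ge0.
pose P k (Q : nat -> 'rV[R]_n.+1 * 'rV[R]_n.+1) :=
  A k `<=` \bigcup_i box (Q i) /\
  \sum_(i <oo) (box_volume (Q i))%:E <=
    lebesgue_outer (A k) + (e%:num / (2 ^ k.+1)%:R)%:E.
have [G PG] : {G : nat -> nat -> 'rV[R]_n.+1 * 'rV[R]_n.+1
              & forall k, P k (G k)}.
  apply: (@choice _ _ P) => k; rewrite /P /lebesgue_outer.
  set S := (X in ereal_inf X).
  have en1 : (0 < e%:num / (2 ^ k.+1)%:R)%R by [].
  have Sfin : ereal_inf S \is a fin_num.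
    rewrite ge0_fin_numE; last exact: (lebesgue_outer_ge0 (A k)).
    by rewrite ltey; apply/eqP; exact: (Aoo k).
  have [x [Q AQ <-] xS] := lb_ereal_inf_adherent en1 Sfin.
  by exists Q; split => //; exact: ltW.
pose v (i : nat * nat) := (box_volume (uncurry G i))%:E.
have v0 i : 0 <= v i by exact: box_volume_ge0.
apply: (@le_trans _ _ (\esum_(i in setT) v i)).
  apply: ereal_inf_lbound => /=.
  have /card_esym/ppcard_eqP[f] := card_nat2.
  exists (uncurry G \o f).
    move=> t [i _ Ait]; have [j _ Gij] := (PG i).1 t Ait.
    by exists (f^-1%FUN (i, j)) => //=; rewrite invK ?inE.
  by rewrite -(esum_pred_image v _ xpredT) ?[fun=> _]set_true ?image_eq.
rewrite (_ : esum _ _ = \sum_(i <oo) \sum_(j <oo) (box_volume (G i j))%:E);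
    last first.
  pose J : nat -> set (nat * nat) := fun i => [set (i, j) | j in setT].
  rewrite (_ : setT = \bigcup_k J k); last first.
    by rewrite predeqE => -[a b]; split => // _; exists a => //; exists b.
  rewrite esum_bigcupT//=; last first.
    apply/trivIsetP => i j _ _ ij.
    rewrite predeqE => -[k m] /=; split => //= -[] [_] _ [<-{k} _].
    by move=> [m' _] [] /esym/eqP; rewrite (negbTE ij).
  rewrite -(image_id [set: nat]) -fun_true esum_pred_image//; last first.
    by move=> k _; exact: esum_ge0.
  apply: eq_eseriesr => /= j _.
  rewrite -(esum_pred_image v (pair j) predT)//=; last first.
    by move=> ? ? _ _; exact: (@can_inj _ _ _ snd).
  by congr esum; rewrite predeqE => -[a b]; split; move=> [i _ <-]; exists i.
apply: lee_lim.
- apply: is_cvg_nneseries => k *.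
  by apply: nneseries_ge0 => m *; exact: box_volume_ge0.
- apply: is_cvg_nneseries => k *; apply: adde_ge0 => //.
  exact: lebesgue_outer_ge0.
- by near=> k; apply: lee_sum => i _; exact: (PG i).2.
Unshelve. all: by end_near. Qed.

HB.instance Definition _ := isOuterMeasure.Build R _ lebesgue_outer
  lebesgue_outer0 lebesgue_outer_ge0 le_lebesgue_outer
  lebesgue_outer_sigma_subadditive.

End lebesgue_outer_measure.

(* A copy of 'rV[R]_n.+1 whose measurable sets are the Caratheodory sets of
   lebesgue_outer, i.e. the complete Lebesgue sigma-algebra. *)
Notation lebesgue_space R n := (caratheodory_type (@lebesgue_outer R n)).

Definition lebesgue_rV (R : realType) (n : nat) :
    set (lebesgue_space R n) -> \bar R := @lebesgue_outer R n.

HB.instance Definition _ (R : realType) (n : nat) :=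
  isMeasure.Build _ (lebesgue_space R n) R (@lebesgue_rV R n)
    (@caratheodory_measure0 R _ (@lebesgue_outer R n))
    (@caratheodory_measure_ge0 R _ (@lebesgue_outer R n))
    (@caratheodory_measure_sigma_additive R _ (@lebesgue_outer R n)).

Section spaces.
Variables (R : realType) (n : nat).
Local Notation E := 'rV[R]_n.+1.
Local Notation L := (lebesgue_space R n).
Local Notation d := (n.+1%:R : R).
Local Notation mu := (@lebesgue_rV R n).
Local Notation modulus := (@ComplexField.Normc.normc R).

Implicit Types (p : E -> \bar R) (q alpha r rho : R) (f g : E -> R[i]).

Definition cmeasurable f :=
  measurable_fun [set: L] (fun x : L => complex.Re (f x)) /\
  measurable_fun [set: L] (fun x : L => complex.Im (f x)).

Definition exponent_class p : Prop :=
  [/\ measurable_fun [set: L] p,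
      forall x, (1 <= p x)%E,
      (1 < ess_inf mu p)%E & (ess_sup mu p < +oo)%E].

(* For p in exponent_class the set {p = +oo} is negligible, so the junk value
   fine +oo = 0 is irrelevant. *)
Definition modular p f (l : R) : \bar R :=
  (\int[mu]_(x in [set: L]) (((modulus (f x) / l) `^ fine (p x))%R)%:E)%E.

Definition luxemburg p f : \bar R :=
  ereal_inf [set l%:E | l in [set l : R | 0 < l /\ (modular p f l <= 1)%E]].

Definition Lvar p : set (E -> R[i]) :=
  [set f | cmeasurable f /\ (luxemburg p f < +oo)%E].

Definition mul_indic f (K : set E) : E -> R[i] := fun x => f x * \1_K x.

Definition Lvar_loc p : set (E -> R[i]) :=
  [set f | cmeasurable f /\
           forall K : set E, compact K -> Lvar p (mul_indic f K)].

Definition cube r (k : 'rV[int]_n.+1) : set E :=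
  [set x | forall j, r * (k ord0 j)%:~R <= x ord0 j
                       < r * ((k ord0 j)%:~R + 1)].

Definition amalgam_norm p q f : \bar R :=
  ((\esum_(k in [set: 'rV[int]_n.+1])
       luxemburg p (mul_indic f (cube 1%R k)) `^ q)
     `^ (q^-1)%R)%E.

Definition amalgam p q : set (E -> R[i]) :=
  [set f | Lvar_loc p f /\ (amalgam_norm p q f < +oo)%E].

Definition St alpha rho f : E -> R[i] :=
  fun x => (rho `^ (- (d / alpha)))%:C%C * f (rho^-1 *: x).

Definition sum_in_Lvar_loc p (u : nat -> E -> R[i]) f : Prop :=
  forall K : set E, compact K ->
    luxemburg p (mul_indic (fun x => f x - \sum_(k < N) u k x) K)
      @[N --> \oo] --> (0 : \bar R).

Definition h_decomposition p q alpha f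
    (c : nat -> R[i]) (rhos : nat -> R) (fn : nat -> E -> R[i]) : Prop :=
  [/\ forall k, 0 < rhos k,
      forall k, amalgam p q (fn k) /\ (amalgam_norm p q (fn k) <= 1)%E,
      (\sum_(0 <= k <oo) (modulus (c k))%:E < +oo)%E
    & sum_in_Lvar_loc p (fun k x => c k * St alpha (rhos k) (fn k) x) f].

Definition Hspace p q alpha : set (E -> R[i]) :=
  [set f | Lvar_loc p f /\
           exists c rhos fn, h_decomposition p q alpha f c rhos fn].

Definition sigma p q alpha f : \bar R :=
  ereal_inf [set s | exists c rhos fn,
    [/\ Lvar_loc p f, h_decomposition p q alpha f c rhos fn
      & s = (\sum_(0 <= k <oo) (modulus (c k))%:E)%E]].

Definition Hnorm p q alpha f : \bar R :=
  sigma p q alpha (fun x => (modulus (f x))%:C%C).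

(* Functions are not identified up to almost everywhere equality: this does
   not affect separability, as a.e. equal functions are at distance 0. *)
Definition separable_for (nrm : (E -> R[i]) -> \bar R)
    (V : set (E -> R[i])) : Prop :=
  exists D : set (E -> R[i]),
    [/\ countable D, D `<=` V
      & forall f, V f -> forall e : R, 0 < e ->
          exists2 g, D g & (nrm (fun x => f x - g x)%R < e%:E)%E].

End spaces.

(* Main.v *)
Require Import Defs.
From mathcomp Require Import all_boot all_order all_algebra.
From mathcomp Require Import all_classical all_reals all_analysis.
From mathcomp Require Import measurable_realfun ess_sup_inf complex.
From mathcomp Require Import ring lra zify.

Set Implicit Arguments.
Unset Strict Implicit.
Unset Printing Implicit Defensive.
Import Order.TTheory GRing.Theory Num.Theory.
Import numFieldNormedType.Exports.

Local Open Scope classical_set_scope.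
Local Open Scope ring_scope.

(** The space is separable because rational step functions are dense in it.

    Take [f] in the space, with a decomposition into dilated atoms with
    coefficients [c k].  Keep the first [N] terms, the sum of the remaining
    [c k] being small.  Each of these atoms [fn k] is close, in the amalgam
    norm, to its truncation [bn k], which is bounded with bounded support
    ([amalgam_truncation]: dominated convergence for the modular, which needs
    the exponent to be essentially bounded, and summability over the unit
    cubes).  The sum [B] of the dilated [bn k] is again bounded with bounded
    support, whatever the dilation ratios, so a single amalgam norm controls it
    and the uncountably many ratios disappear: [B] is close in that norm to some
    [g] in one fixed countable set ([rational_steps_dense]).

    The error is then read off one decomposition.  Write [f - g] as
    [(f - B) + (B - g)]: replacing each of the first [N] atoms [fn k] by
    [fn k - bn k] turns the decomposition of [f] into one of [f - B] with small
    coefficients ([h_decomposition_replace]), and [B - g] is one more atom, of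
    dilation ratio one, put in front of it ([h_decomposition_cons]).  The norm
    is the gauge of the modulus [|f - g|], but [|f - g| = u (f - g)] for a
    measurable [u] with values in the unit disc, and multiplication by [u] maps
    atoms to atoms ([h_decomposition_mul], [Hnorm_le_decomposition]).  That [u]
    is evaluated at dilated points is harmless since dilations preserve Lebesgue
    measurability ([measurable_dilate]).

    Density in the amalgam norm of a fixed cube comes down to indicators, since
    bounded functions have binary expansions ([dyadic_approximable]); and a
    measurable set of finite measure differs little from a finite union of
    rational boxes, by the very definition of the outer measure
    ([rat_figure_approx]). *)

(** * Boxes and Lebesgue measurable sets *)

Lemma nneseries_tail_small (R : realType) (u : nat -> \bar R) (e : R) :
  (forall k, (0 <= u k)%E) -> (\sum_(0 <= k <oo) u k < +oo)%E -> 0 < e ->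
  exists N, (\sum_(N <= k <oo) u k <= e%:E)%E.
Proof.
move=> u0 ufin e0.
have /fine_cvgP[tfin tcvg] : (\sum_(N <= k <oo) u k)%E @[N --> \oo] -->
  (0 : \bar R).
  exact: nneseries_tail_cvg.
have /cvgrPdist_le /(_ _ e0) tcvg' := tcvg.
near \oo => N; exists N.
have Nfin : (\sum_(N <= k <oo) u k)%E \is a fin_num by near: N.
rewrite -(fineK Nfin) lee_fin.
have : `|0 - (fine \o (fun N : nat => (\sum_(N <= k <oo) u k)%E)) N| <= e
  by near: N.
by rewrite sub0r normrN /=; apply: le_trans; exact: ler_norm.
Unshelve. all: by end_near. Qed.

Section boxes.
Variables (R : realType) (n : nat).
Local Notation E := 'rV[R]_n.+1.
Local Notation L := (lebesgue_space R n).
Local Notation mu := (@lebesgue_rV R n).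
Implicit Types (Q : E * E) (A : set E).

Definition box_below (j : 'I_n.+1) (c : R) Q : E * E :=
  (Q.1, \row_i if i == j then Num.min (Q.2 ord0 i) c else Q.2 ord0 i).

Definition box_above (j : 'I_n.+1) (c : R) Q : E * E :=
  (\row_i if i == j then Num.max (Q.1 ord0 i) c else Q.1 ord0 i, Q.2).

Lemma box_belowE j c Q : box (box_below j c Q) =
  box Q `&` [set x | x ord0 j < c].
Proof.
apply/seteqP; split => [x /= bx|x /= [bx xc] i /=].
  split=> [i|].
    have /= := bx i; rewrite mxE; case: ifP => // _ /andP[-> /=].
    by rewrite lt_min => /andP[].
  by have /= := bx j; rewrite mxE eqxx lt_min => /andP[_ /andP[]].
have /andP[-> xQ2] := bx i; rewrite mxE; case: ifP => [/eqP ->|//].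
by rewrite lt_min xc andbT; have /andP[_ ->] := bx j.
Qed.

Lemma box_aboveE j c Q :
  box (box_above j c Q) = box Q `&` ~` [set x | x ord0 j < c].
Proof.
apply/seteqP; split => [x /= bx|x /= [bx /negP xc] i /=].
  split=> [i|].
    have /= := bx i; rewrite mxE; case: ifP => // _ /andP[+ -> /=].
    by rewrite ge_max => /andP[-> ].
  have /= := bx j; rewrite mxE eqxx ge_max => /andP[/andP[_ + _]].
  by move=> cx; apply/negP; rewrite -leNgt.
have /andP[xQ1 ->] := bx i; rewrite mxE; case: ifP => [/eqP ->|]; last
  by rewrite xQ1.
rewrite ge_max [c <= _]leNgt xc !andbT; by have /andP[->] := bx j.
Qed.

Lemma box_volume_split j c Q :
  box_volume Q = box_volume (box_below j c Q) + box_volume (box_above j c Q).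
Proof.
have D1 (F : 'I_n.+1 -> R) : \prod_i F i = F j * \prod_(i | i != j) F i.
  exact: bigD1.
rewrite /box_volume !D1 /= !mxE eqxx.
rewrite [X in _ = _ * X + _](eq_bigr
  (fun i => Num.max 0 (Q.2 ord0 i - Q.1 ord0 i))); last first.
  by move=> i ij; rewrite mxE (negbTE ij).
rewrite [X in _ = _ + _ * X](eq_bigr
  (fun i => Num.max 0 (Q.2 ord0 i - Q.1 ord0 i))); last first.
  by move=> i ij; rewrite mxE (negbTE ij).
rewrite -mulrDl; congr (_ * _).
move: (Q.2 ord0 j) (Q.1 ord0 j) => b a.
have maxE (u v : R) : Num.max u v = if u <= v then v else u by rewrite maxC;
  case: leP.
have minE (u v : R) : Num.min u v = if u <= v then u else v by case: leP.
rewrite !maxE minE.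
by case: (leP b c) => ?; case: (leP a c) => ?; do ?case: leP => ?; lra.
Qed.

(** A hyperplane cuts each box into two boxes whose volumes add up, hence it
    cuts any cover of a set into covers of the two pieces with the same total
    volume. *)
Lemma measurable_halfspace (j : 'I_n.+1) (c : R) :
  measurable ([set x | x ord0 j < c] : set L).
Proof.
apply: le_caratheodory_measurable => X.
apply: le_ereal_inf_tmp => _ [Q XQ <-].
rewrite (eq_eseriesr (g := fun k => ((box_volume (box_below j c (Q k)))%:E +
   (box_volume (box_above j c (Q k)))%:E)%E)); last first.
  by move=> k _; rewrite (box_volume_split j c) EFinD.
rewrite nneseriesD //; try by move=> *; exact: box_volume_ge0.
apply: leeD; apply: ereal_inf_lbound; eexists => //=.
- by move=> x [/XQ[k _ Qx] xc]; exists k => //; rewrite box_belowE.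
- by move=> x [/XQ[k _ Qx] xc]; exists k => //; rewrite box_aboveE.
Qed.

Lemma measurable_box Q : measurable (box Q : set L).
Proof.
rewrite (_ : box Q = \bigcap_(j in [set: 'I_n.+1])
  (~` [set x : E | x ord0 j < Q.1 ord0 j] `&`
    [set x : E | x ord0 j < Q.2 ord0 j])).
  apply: (@fin_bigcap_measurable _ L) => [|j _]; first exact: finite_finset.
  apply: measurableI; last exact: measurable_halfspace.
  by apply: measurableC; exact: measurable_halfspace.
apply/seteqP; split => [x /= bx j _ /=|x /= bx j].
  by have /andP[? ?] := bx j; split => //; apply/negP; rewrite -leNgt.
by have [/= /negP ? ->] := bx j I; rewrite leNgt andbT.
Qed.

Lemma lebesgue_box_le Q : (mu (box Q) <= (box_volume Q)%:E)%E.
Proof.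
apply: ereal_inf_lbound => /=.
exists (fun k => if k == 0%N then Q else (0, 0)); first by move=> x Qx;
  exists 0%N.
rewrite (nneseries_split 0 1); last by move=> k _; exact: box_volume_ge0.
rewrite add0n big_nat1 /= [X in (_ + X)%E]eseries0 ?adde0 //= => k k1 _.
rewrite gtn_eqF // /box_volume.
by rewrite big_ord_recl /= subrr maxxx mul0r.
Qed.

(** Dilating a cover of [A] gives a cover of the dilated set, with volumes
    multiplied by the same power of the ratio. *)
Lemma lebesgue_outer_dilate (r : R) A : 0 < r ->
  (lebesgue_outer [set x | A (r *: x)%R] <=
    (r^-1 ^+ n.+1)%:E * lebesgue_outer A)%E.
Proof.
move=> r0; have ri0 : 0 < r^-1 ^+ n.+1 by rewrite exprn_gt0 // invr_gt0.
rewrite -lee_pdivrMl //; apply: le_ereal_inf_tmp => _ [Q AQ <-].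
rewrite lee_pdivrMl // -nneseriesZl; last by move=> *; exact: box_volume_ge0.
apply: ereal_inf_lbound => /=;
  exists (fun k => (r^-1 *: (Q k).1, r^-1 *: (Q k).2)).
  move=> x /= /AQ[k _ Qx]; exists k => // j /=; have /= := Qx j; rewrite !mxE.
  by rewrite ler_pdivrMl // ltr_pdivlMl.
apply: eq_eseriesr => k _; rewrite -EFinM; congr (_%:E).
rewrite /box_volume -[X in _ ^+ X]card_ord -prodr_const -big_split /=.
apply: eq_bigr => j _; rewrite !mxE -mulrBr maxr_pMr ?invr_ge0 ?ltW //.
by rewrite mulr0.
Qed.

Lemma measurable_dilate (r : R) A : 0 < r ->
  measurable (A : set L) -> measurable ([set x | A (r *: x)] : set L).
Proof.
move=> r0 mA; apply: le_caratheodory_measurable => X.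
have rn0 : r != 0 by rewrite gt_eqF.
pose Y : set E := [set y | X (r^-1 *: y)].
have XA B : X `&` [set x | B (r *: x)] = [set x | (Y `&` B) (r *: x)].
  by apply/seteqP; split => x /=; rewrite /Y /= scalerA mulVf // scale1r.
rewrite (_ : ~` _ = [set x | (~` A) (r *: x)]) // !XA.
apply: le_trans (leeD (lebesgue_outer_dilate _ r0)
  (lebesgue_outer_dilate _ r0)) _.
rewrite -ge0_muleDr ?lebesgue_outer_ge0 // -mA.
have ri0 : 0 < r^-1 by rewrite invr_gt0.
rewrite -lee_pdivlMl ?exprn_gt0 // -exprVn.
exact: lebesgue_outer_dilate ri0.
Qed.

Definition rat_box (q : 'rV[rat]_n.+1 * 'rV[rat]_n.+1) : E * E :=
  (map_mx ratr q.1, map_mx ratr q.2).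

(** An open set is the union of the countably many rational boxes that it
    contains. *)
Lemma open_measurable_rV (U : set E) : open U -> measurable (U : set L).
Proof.
move=> oU.
rewrite (_ : U =
  \bigcup_q (if `[< box (rat_box q) `<=` U >] then box (rat_box q) else set0)).
  apply: (@countable_bigcupT_measurable _ L); first exact: countableP.
  by move=> q; case: ifP => _; [exact: measurable_box|exact: measurable0].
apply/seteqP; split => [x Ux|x [q _]]; last by case: asboolP => // /[apply].
have := open_nbhs_nbhs (conj oU Ux); move=> /nbhs_ballP[e /= e0 eU].
have /fin_all_exists[a Ha] (j : 'I_n.+1) : exists a : rat,
  ratr a \in `](x ord0 j - e), x ord0 j[.
  by apply: rat_in_itvoo; rewrite ltrBlDr ltrDl.
have /fin_all_exists[b Hb] (j : 'I_n.+1) : exists a : rat, ratr a \in `]x ord0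
  j, (x ord0 j + e)[.
  by apply: rat_in_itvoo; rewrite ltrDl.
exists (\row_j a j, \row_j b j) => //; rewrite asboolT => [j|y yab].
  rewrite /= !mxE; have := Ha j; have := Hb j; rewrite !in_itv /=.
  by move=> /andP[-> _] /andP[_ /ltW ->].
apply: eU; split => // i j; rewrite ord1 /ball /=.
have := yab j; have := Ha j; have := Hb j; rewrite /= !mxE !in_itv /=.
by move=> /andP[? ?] /andP[? ?] /andP[? ?]; rewrite ltr_distl; lra.
Qed.

Lemma compact_measurable_rV (K : set E) : compact K -> measurable (K : set L).
Proof.
move=> cK; rewrite -[K]setCK; apply: measurableC; apply: open_measurable_rV.
by apply: closed_openC; apply: compact_closed => //; exact: norm_hausdorff.
Qed.

(** The volume depends continuously on the amount by which a box is enlarged. *)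
Lemma rat_box_approx Q (e : R) : 0 < e ->
  exists q, box Q `<=` box (rat_box q) /\ box_volume (rat_box q) <=
    box_volume Q + e.
Proof.
move=> e0.
(* [F t] is the volume of [Q] enlarged by [t] on every side *)
pose F (t : R) := \prod_(j < n.+1) Num.max 0 (Q.2 ord0 j - Q.1 ord0 j + t *+ 2).
have cF : {for 0, continuous F}.
  apply: continuous_big => [|j _ t]; first exact: mul_continuous.
  have cl : {for t, continuous (fun t => Q.2 ord0 j - Q.1 ord0 j + t *+ 2)}.
    by apply: continuousD; [exact: cst_continuous|exact: natmul_continuous].
  exact: (@continuous_max R R (fun=> 0) _ t (@cst_continuous _ _ _ _) cl).
have F0 : F 0 = box_volume Q.
  by apply: eq_bigr => j _; rewrite mul0rn addr0.
have [d /= d0 dF] : exists2 d : R, 0 < d & F d <= F 0 + e.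
  have /cvgrPdist_le /(_ _ e0) /nbhs_ballP[d /= d0 H] := cF.
  exists (d / 2); first by rewrite divr_gt0.
  have /H : ball 0 d (d / 2).
    by rewrite /ball /= sub0r normrN ger0_norm ?divr_ge0 ?ltW //; lra.
  by rewrite distrC ler_distl => /andP[].
have /fin_all_exists[a Ha] (j : 'I_n.+1) : exists a : rat,
  ratr a \in `](Q.1 ord0 j - d), Q.1 ord0 j[.
  by apply: rat_in_itvoo; rewrite ltrBlDr ltrDl.
have /fin_all_exists[b Hb] (j : 'I_n.+1) : exists a : rat, ratr a \in `]Q.2
  ord0 j, (Q.2 ord0 j + d)[.
  by apply: rat_in_itvoo; rewrite ltrDl.
exists (\row_j a j, \row_j b j); split.
  move=> x Qx j; rewrite /= !mxE; have := Ha j; have := Hb j; have := Qx j.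
  rewrite !in_itv /= => /andP[? ?] /andP[? ?] /andP[? ?]; lra.
rewrite -F0; apply: le_trans dF; apply: ler_prod => j _.
rewrite le_max lexx /=; have := Ha j; have := Hb j.
rewrite !mxE !in_itv /= mulr2n => /andP[? ?] /andP[? ?].
by rewrite ge_max le_max lexx /= le_max; apply/orP; right; lra.
Qed.

Definition rat_figure (s : seq ('rV[rat]_n.+1 * 'rV[rat]_n.+1)) : set E :=
  \big[setU/set0]_(q <- s) box (rat_box q).

Lemma measurable_rat_figure s : measurable (rat_figure s : set L).
Proof.
rewrite /rat_figure; elim/big_ind: _ => [|A B|q _]; first exact: measurable0.
- exact: measurableU.
- exact: measurable_box.
Qed.

(** A cover that is nearly optimal for the outer measure exceeds [A] by little;
    its tail has small total volume and can be dropped. *)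
Lemma rat_figure_approx A (e : R) : measurable (A : set L) ->
  (mu A < +oo)%E -> 0 < e ->
  exists s, (mu ((A `\` rat_figure s) `|` (rat_figure s `\` A)) <= e%:E)%E.
Proof.
move=> mA Afin e0; have e40 : 0 < e / 4 by rewrite divr_gt0.
have mAf : mu A \is a fin_num by rewrite ge0_fin_numE // measure_ge0.
have [_ [Q AQ <-] Qlt] := lb_ereal_inf_adherent e40 mAf.
(* the [k]-th box may be enlarged by [v k], for a total excess of [e / 4] *)
pose v k := e / 4 / (2 ^ k.+1)%:R.
have v0 k : 0 < v k by rewrite divr_gt0 // ltr0n expn_gt0.
have [q Hq] := choice (fun k => rat_box_approx (Q k) (v0 k)).
pose V k := (box_volume (rat_box (q k)))%:E.
have V0 k : (0 <= V k)%E by exact: box_volume_ge0.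
have sV : (\sum_(0 <= k <oo) V k <= mu A + (e / 2)%:E)%E.
  apply: (@le_trans _ _ (\sum_(0 <= k <oo)
    ((box_volume (Q k))%:E + (e / 4 / (2 ^ k.+1)%:R)%:E))%E).
    by apply: lee_nneseries => [k _ _|k _];
      [exact: V0|rewrite -EFinD lee_fin; have [] := Hq k].
  apply: le_trans (epsilon_trick _ _ _) _ => //.
  - by move=> k; exact: box_volume_ge0.
  - exact: ltW.
  rewrite (_ : e / 2 = e / 4 + e / 4); last by field.
  by rewrite EFinD addeA leeD2r // ltW.
have sVfin : (\sum_(0 <= k <oo) V k < +oo)%E.
  by apply: le_lt_trans sV _; rewrite lte_add_pinfty // ltry.
have [N tN] := nneseries_tail_small V0 sVfin (divr_gt0 e0 (ltr0Sn R 1)).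
pose C k : set L := box (rat_box (q k)).
have mC k : measurable (C k) by exact: measurable_box.
have muC k : (mu (C k) <= V k)%E by exact: lebesgue_box_le.
have AC : A `<=` \bigcup_k C k.
  by move=> x /AQ[k _ Qx]; exists k => //; have [+ _] := Hq k; exact.
have mbC P : measurable (\bigcup_(k in P) C k) by apply: bigcup_measurable.
exists [seq q k | k <- iota 0 N].
have UE : rat_figure [seq q k | k <- iota 0 N] = \big[setU/set0]_(k < N) C k.
  by rewrite /rat_figure big_map -[in iota 0 N](subn0 N) -/(index_iota 0 N)
    big_mkord.
rewrite UE.
apply: (@le_trans
  _ _ (mu ((\bigcup_k C k `\` A) `|` \bigcup_(k in [set k | (N <= k)%N]) C k))).
  apply: le_measure; rewrite ?inE.
  - have mU : measurable (\big[setU/set0]_(k < N) C k)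
      by exact: bigsetU_measurable.
    by apply: measurableU; apply: measurableD.
  - by apply: measurableU => //; apply: measurableD.
  move=> x [[/AC [k _ Ck] nU]|[+ nA]]; last first.
    by rewrite -bigcup_mkord => -[k _ Ck]; left; split => //; exists k.
  right; exists k => //=; rewrite leqNgt; apply/negP => kN; apply: nU.
  by rewrite -bigcup_mkord; exists k.
apply: le_trans (measureU2 _ _ _) _ => //; first exact: measurableD.
rewrite (_ : e%:E = (e / 2)%:E + (e / 2)%:E)%E; last by rewrite -EFinD;
  congr (_%:E); field.
apply: leeD; last first.
  apply: le_trans tN; apply: le_trans
    (lee_nneseries (fun k _ _ => measure_ge0 mu (C k)) (fun k _ => muC k)).
  rewrite (_ : \bigcup_(k in _) C k = \bigcup_k (C (k + N)%N)); last first.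
    apply/seteqP; split => [x [k /= Nk Ck]|x [k _ Ck]]; last
      by exists (k + N)%N => //=; exact: leq_addl.
    by exists (k - N)%N => //; rewrite subnK.
  rewrite -[N in leRHS]add0n -nneseries_addn; last by move=> *;
    exact: measure_ge0.
  by apply: measure_sigma_subadditive => //; apply: bigcup_measurable.
rewrite measureD //; last 1 first.
  apply: le_lt_trans sVfin; apply: le_trans
    (lee_nneseries (fun k _ _ => measure_ge0 mu (C k)) (fun k _ => muC k)).
  by apply: measure_sigma_subadditive.
rewrite setIidr // leeBlDl //; apply: le_trans sV.
apply: le_trans (lee_nneseries (fun k _ _ => measure_ge0 mu (C k))
  (fun k _ => muC k)).
by apply: measure_sigma_subadditive.
Qed.

End boxes.

(** * Measurability of complex functions *)

Section complex_measurability.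
Variables (R : realType) (n : nat).
Local Notation E := 'rV[R]_n.+1.
Local Notation L := (lebesgue_space R n).
Local Notation modulus := (@ComplexField.Normc.normc R).
Implicit Types (f g h : E -> R[i]) (A : set E).

Lemma modulus_ge0 (z : R[i]) : 0 <= modulus z.
Proof. by case: z => a b; exact: sqrtr_ge0. Qed.

Lemma modulusM (z w : R[i]) : modulus (z * w) = modulus z * modulus w.
Proof. exact: ComplexField.Normc.normcM. Qed.

Lemma modulusD (z w : R[i]) : modulus (z + w) <= modulus z + modulus w.
Proof. exact: (@le_normcD R z w). Qed.

Lemma modulusN (z : R[i]) : modulus (- z) = modulus z.
Proof. exact: (@normcN R z). Qed.

Lemma modulus_real (a : R) : modulus a%:C%C = `|a|.
Proof. by rewrite /= expr0n /= addr0 sqrtr_sqr. Qed.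

Lemma cmeasurable_real (a : E -> R) :
  measurable_fun [set: L] (a : L -> R) -> cmeasurable (fun x => (a x)%:C%C).
Proof. by move=> ma; split => //=; exact: measurable_cst. Qed.

Lemma cmeasurable_cst (z : R[i]) : @cmeasurable R n (fun=> z).
Proof. by split; exact: measurable_cst. Qed.

Lemma cmeasurableD f g :
  cmeasurable f -> cmeasurable g -> cmeasurable (fun x => f x + g x).
Proof.
move=> [rf imf] [rg img]; split.
  rewrite (_ : (fun x : L => _) =
    (fun x : L => complex.Re (f x)) \+ (fun x : L => complex.Re (g x))).
    exact: measurable_funD.
  by apply/funext => x /=; case: (f x); case: (g x).
rewrite (_ : (fun x : L => _) =
  (fun x : L => complex.Im (f x)) \+ (fun x : L => complex.Im (g x))).
  exact: measurable_funD.
by apply/funext => x /=; case: (f x); case: (g x).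
Qed.

Lemma cmeasurableM f g :
  cmeasurable f -> cmeasurable g -> cmeasurable (fun x => f x * g x).
Proof.
move=> [rf imf] [rg img]; split.
  rewrite (_ : (fun x : L => _) =
    ((fun x : L => complex.Re (f x)) \* (fun x : L => complex.Re (g x)))
     \- ((fun x : L => complex.Im (f x)) \* (fun x : L => complex.Im (g x)))).
    by apply: measurable_funB; exact: measurable_funM.
  by apply/funext => x /=; case: (f x); case: (g x).
rewrite (_ : (fun x : L => _) =
  ((fun x : L => complex.Re (f x)) \* (fun x : L => complex.Im (g x)))
   \+ ((fun x : L => complex.Im (f x)) \* (fun x : L => complex.Re (g x)))).
  by apply: measurable_funD; exact: measurable_funM.
by apply/funext => x /=; case: (f x); case: (g x).
Qed.

Lemma cmeasurableZ (z : R[i]) f : cmeasurable f ->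
  cmeasurable (fun x => z * f x).
Proof. by apply: cmeasurableM; exact: cmeasurable_cst. Qed.

Lemma cmeasurableB f g :
  cmeasurable f -> cmeasurable g -> cmeasurable (fun x => f x - g x).
Proof.
move=> mf mg.
have -> : (fun x => f x - g x) = (fun x => f x + (-1) * g x).
  by apply/funext => x; rewrite mulN1r.
exact: (cmeasurableD mf (cmeasurableZ (-1) mg)).
Qed.

Lemma cmeasurable_indic A : measurable (A : set L) -> @cmeasurable R n (\1_A).
Proof.
move=> mA; rewrite (_ : \1_A = fun x => ((\1_A x : R))%:C%C).
  by apply: cmeasurable_real; exact: measurable_indic.
by apply/funext => x; rewrite !indicE rmorph_nat.
Qed.

Lemma cmeasurable_mul_indic f A :
  cmeasurable f -> measurable (A : set L) -> cmeasurable (mul_indic f A).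
Proof. by move=> mf mA; exact: (cmeasurableM mf (cmeasurable_indic mA)). Qed.

Lemma measurable_modulus f :
  cmeasurable f -> measurable_fun [set: L] (fun x : L => modulus (f x)).
Proof.
move=> [rf imf].
rewrite (_ : (fun x => _) =
  (fun x : L => ((complex.Re (f x)) ^+ 2 + (complex.Im (f x)) ^+ 2) `^ 2^-1)).
  apply: (@measurableT_comp _ _ _ _ _ _ (@powR R ^~ 2^-1));
    first exact: measurable_powR.
  by apply: measurable_funD; exact: measurable_funX.
by apply/funext => x; rewrite powR12_sqrt ?addr_ge0 ?sqr_ge0 //; case: (f x).
Qed.

Lemma measurable_invr_ge0 (a : E -> R) : (forall x, 0 <= a x) ->
  measurable_fun [set: L] (a : L -> R) ->
    measurable_fun [set: L] (fun x : L => (a x)^-1).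
Proof.
move=> a0 ma; rewrite (_ : (fun x => _) = (fun x : L => a x `^ (-1))).
  by apply: (@measurableT_comp _ _ _ _ _ _ (@powR R ^~ (-1)));
    [exact: measurable_powR|exact: ma].
by apply/funext => x; rewrite powR_inv1.
Qed.

Lemma measurable_powR_fun (a e : E -> R) :
  measurable_fun [set: L] (a : L -> R) -> measurable_fun [set: L] (e : L -> R) ->
  measurable_fun [set: L] (fun x : L => a x `^ e x).
Proof.
move=> ma me.
have mln : measurable_fun [set: L] (fun x : L => expR (e x * ln (a x))).
  apply: (measurableT_comp (@measurable_expR R)); apply: (measurable_funM me).
  by apply: (measurableT_comp (@measurable_ln R)); exact: ma.
have meq (b : E -> R) : measurable_fun [set: L] (b : L -> R) ->
    measurable_fun [set: L] (fun x : L => b x == 0).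
  by move=> mb; exact: (measurable_fun_eqr mb (@measurable_cst _ _ L R setT 0)).
have m0 : measurable_fun [set: L] (fun x : L => if e x == 0 then 1 else 0 : R).
  apply: measurable_fun_ifT;
    [exact: (meq e)|exact: measurable_cst|exact: measurable_cst].
have -> : (fun x : L => a x `^ e x) =
    (fun x : L => if a x == 0 then if e x == 0 then 1 else 0 else expR
      (e x * ln (a x))).
  by apply/funext => x; rewrite /powR; case: (e x == 0).
exact: (measurable_fun_ifT (meq a ma) m0 mln).
Qed.

Lemma measurable_density (r : E -> R) f (l : R) :
  measurable_fun [set: L] (r : L -> R) -> cmeasurable f ->
  measurable_fun [set: L] (fun x : L => ((modulus (f x) / l) `^ r x)%:E).
Proof.
move=> mr mf; apply/measurable_EFinP; apply: (measurable_powR_fun _ mr).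
exact: (measurable_funM (measurable_modulus mf) (measurable_cst _)).
Qed.

Lemma cmeasurable_dilate f (r : R) :
  0 < r -> cmeasurable f -> cmeasurable (fun x => f (r *: x)).
Proof.
move=> r0 [rf imf]; split => _ B mB; rewrite setTI.
  have := rf measurableT B mB; rewrite setTI => mr.
  exact: (measurable_dilate r0 mr).
have := imf measurableT B mB; rewrite setTI => mr.
exact: (measurable_dilate r0 mr).
Qed.

(** The factor of modulus at most one that carries [h] to its modulus; it is
    zero where [h] is, thanks to [0^-1 = 0]. *)
Definition phase h : E -> R[i] :=
  fun x => ((modulus (h x))^-1)%:C%C * (h x)^*%C.

Lemma phaseM h x : phase h x * h x = (modulus (h x))%:C%C.
Proof.
rewrite /phase -mulrA [_^*%C * _]mulrC.
have -> : h x * (h x)^*%C = ((modulus (h x)) ^+ 2)%:C%C.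
  case: (h x) => a b /=; rewrite sqr_sqrtr ?addr_ge0 ?sqr_ge0 //.
  by apply/eqP; rewrite eq_complex /=; apply/andP; split; apply/eqP; ring.
rewrite -rmorphM /=; have [->|h0] := eqVneq (modulus (h x)) 0; first
  by rewrite expr0n mulr0.
by rewrite expr2 mulKf.
Qed.

Lemma phase_le1 h x : modulus (phase h x) <= 1.
Proof.
rewrite /phase modulusM modulus_real ger0_norm ?invr_ge0 ?modulus_ge0 //.
have -> : modulus (h x)^*%C = modulus (h x) by case: (h x) => a b /=;
  rewrite sqrrN.
have [->|h0] := eqVneq (modulus (h x)) 0; first by rewrite mulr0 ler01.
by rewrite mulVf.
Qed.

Lemma cmeasurable_phase h : cmeasurable h -> cmeasurable (phase h).
Proof.
move=> mh; apply: cmeasurableM.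
  apply: cmeasurable_real; apply: measurable_invr_ge0 => [x|];
    first exact: modulus_ge0.
  exact: measurable_modulus.
case: mh => rh imh; split.
  by rewrite (_ : (fun x : L => _) = (fun x : L => complex.Re (h x))) //;
    apply/funext => x; case: (h x).
rewrite (_ : (fun x : L => _) = \- (fun x : L => complex.Im (h x))).
  exact: measurable_funN.
by apply/funext => x /=; case: (h x).
Qed.

End complex_measurability.

(** * The modular and the Luxemburg norm *)

Section modular_theory.
Variables (R : realType) (n : nat).
Local Notation E := 'rV[R]_n.+1.
Local Notation L := (lebesgue_space R n).
Local Notation mu := (@lebesgue_rV R n).
Local Notation modulus := (@ComplexField.Normc.normc R).
Variable p : E -> \bar R.
Hypothesis hp : exponent_class p.
Implicit Types (f g h : E -> R[i]) (A : set E) (l : R).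

(** Off a null set the exponent is finite and at most its essential supremum,
    so in the modular it can be replaced by an everywhere bounded one. *)
Lemma bounded_exponent : exists r : E -> R, exists P : R,
  [/\ measurable_fun [set: L] (r : L -> R), forall x, 1 <= r x <= P
    & forall f l, cmeasurable f ->
        modular p f l =
          (\int[mu]_(x in [set: L]) ((modulus (f x) / l) `^ r x)%:E)%E].
Proof.
have [mp p1 _ psup] := hp.
pose P := Num.max 1 (fine (ess_sup mu p)).
pose e (x : E) := fine (p x).
have me : measurable_fun [set: L] (e : L -> R).
  by apply: (measurableT_comp (fine_measurable _));
    [exact: measurableT|exact: mp].
pose r (x : E) := Num.min P (Num.max 1 (e x)).
have mr : measurable_fun [set: L] (r : L -> R).
  have mc c : measurable_fun [set: L] (cst c : L -> R) by exact: measurable_cst.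
  exact: (measurable_minr (mc P) (measurable_maxr (mc 1) me)).
exists r, P; split; [exact: mr| |] => [x|f l mf].
  by rewrite /r /P ge_min lexx /= andbT le_min !le_max !lexx.
apply: (@ge0_ae_eq_integral _ L R mu setT _ _ measurableT
  (measurable_density l me mf) (measurable_density l mr mf)).
- by move=> x _; rewrite lee_fin powR_ge0.
- by move=> x _; rewrite lee_fin powR_ge0.
apply: filterS (ess_sup_ge mu p) => x px _; congr ((_ `^ _)%:E).
have pfin : p x \is a fin_num.
  rewrite ge0_fin_numE ?(le_lt_trans px) //.
  by apply: le_trans (p1 x); rewrite lee_fin ler01.
have sfin : ess_sup mu p \is a fin_num.
  rewrite ge0_fin_numE //; apply: le_trans px.
  by apply: le_trans (p1 x); rewrite lee_fin ler01.
rewrite /r /e max_r; last by rewrite -lee_fin fineK.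
by rewrite min_r // le_max -[X in _ || X]lee_fin !fineK // px orbT.
Qed.

Lemma modular_le f g l l' : cmeasurable f -> cmeasurable g -> 0 < l -> 0 < l' ->
  (forall x, modulus (f x) / l <= modulus (g x) / l') ->
  (modular p f l <= modular p g l')%E.
Proof.
move=> mf mg l0 l'0 fg; have [r [P [mr r1 rE]]] := bounded_exponent.
rewrite (rE f l mf) (rE g l' mg).
apply: (@ge0_le_integral _ L R mu setT measurableT
  _ _ _ (measurable_density l mr mf) (measurable_density l' mr mg)).
  by move=> x _; rewrite lee_fin powR_ge0.
move=> x _; have r0 : 0 <= r x by have /andP[/(le_trans ler01)] := r1 x.
by rewrite lee_fin ge0_ler_powR ?nnegrE ?divr_ge0 ?modulus_ge0 ?(ltW l0)
  ?(ltW l'0) ?fg.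
Qed.

Lemma convex_powR_div (a b u v r : R) : 0 < a -> 0 < b -> 0 <= u -> 0 <= v ->
  1 <= r ->
  ((u + v) / (a + b)) `^ r <= a / (a + b) * (u / a) `^ r + b / (a + b)
    * (v / b) `^ r.
Proof.
move=> a0 b0 u0 v0 r1; have ab0 : 0 < a + b by rewrite addr_gt0.
have t0 : 0 <= a / (a + b) by rewrite divr_ge0 // ltW.
have t1 : a / (a + b) <= 1 by rewrite ler_pdivrMr // mul1r lerDl ltW.
have := @convex_powR R r r1 (Itv01 t0 t1) (u / a) (v / b).
rewrite !inE /= !in_itv /= !andbT
  => /(_ (divr_ge0 u0 (ltW a0)) (divr_ge0 v0 (ltW b0))).
rewrite convRE [X in X `^ _ <= _ -> _]convRE /=.
have oE : unstable.onem (a / (a + b)) = b / (a + b).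
  by rewrite /unstable.onem; field; rewrite gt_eqF.
rewrite !oE; apply: le_trans; rewrite le_eqVlt; apply/orP; left; apply/eqP;
  congr (_ `^ _).
by field; rewrite !gt_eqF.
Qed.

(** [(f + g) / (a + b)] is a convex combination of [f / a] and [g / b], and
    [t ^ r] is convex in [t]. *)
Lemma modularD f g (a b : R) : cmeasurable f -> cmeasurable g -> 0 < a ->
  0 < b ->
  (modular p f a <= 1)%E -> (modular p g b <= 1)%E ->
  (modular p (fun x => f x + g x)%R (a + b)%R <= 1)%E.
Proof.
move=> mf mg a0 b0; have [r [P [mr r1 rE]]] := bounded_exponent.
have ab0 : 0 < a + b by rewrite addr_gt0.
have mfg := cmeasurableD mf mg.
rewrite (rE f a mf) (rE g b mg) (rE _ (a + b) mfg) => fa gb.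
have mfa := measurable_density a mr mf; have mgb := measurable_density b mr mg.
have ca0 : (0 <= (a / (a + b))%:E)%E by rewrite lee_fin divr_ge0 // ltW.
have cb0 : (0 <= (b / (a + b))%:E)%E by rewrite lee_fin divr_ge0 // ltW.
have mca := measurable_funeM (a / (a + b))%:E mfa.
have mcb := measurable_funeM (b / (a + b))%:E mgb.
apply: (@le_trans _ _ (\int[mu]_(x in [set: L])
  ((a / (a + b))%:E * ((modulus (f x) / a) `^ r x)%:E
    + (b / (a + b))%:E * ((modulus (g x) / b) `^ r x)%:E))%E).
  apply: (@ge0_le_integral _ L R mu setT measurableT
    _ _ _ (measurable_density (a + b) mr mfg) (emeasurable_funD mca mcb)).
    by move=> x _; rewrite lee_fin powR_ge0.
  move=> x _; rewrite -!EFinM -EFinD lee_fin.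
  have /andP[r1x _] := r1 x.
  apply: le_trans (convex_powR_div a0 b0 (modulus_ge0 _) (modulus_ge0 _) r1x).
  have r0 : 0 <= r x by exact: le_trans r1x.
  rewrite ge0_ler_powR ?nnegrE ?divr_ge0 ?addr_ge0 ?modulus_ge0 ?(ltW ab0)
    ?(ltW a0) ?(ltW b0) //.
  by rewrite ler_pM2r ?invr_gt0 // modulusD.
rewrite (ge0_integralD mu measurableT _ mca _ mcb); last 2 first.
- by move=> x _; rewrite mule_ge0 // lee_fin powR_ge0.
- by move=> x _; rewrite mule_ge0 // lee_fin powR_ge0.
rewrite (ge0_integralZl mu measurableT mfa _ ca0); last by move=> x _;
  rewrite lee_fin powR_ge0.
rewrite (ge0_integralZl mu measurableT mgb _ cb0); last by move=> x _;
  rewrite lee_fin powR_ge0.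
have -> : (1 = (a / (a + b))%:E * 1 + (b / (a + b))%:E * 1 :> \bar R)%E.
  by rewrite !mule1 -EFinD -mulrDl divff ?gt_eqF.
exact: (leeD (lee_wpmul2l ca0 fa) (lee_wpmul2l cb0 gb)).
Qed.

(** With [P] a bound of the exponent: [t ^ r <= t + t ^ P] for [0 <= t] and
    [1 <= r <= P]. *)
Lemma modular_bounded : exists2 P : R, 1 <= P & forall f A (C l : R),
  cmeasurable f ->
  measurable (A : set L) -> 0 <= C -> 0 < l ->
  (forall x, modulus (f x) <= C * \1_A x) ->
  (modular p f l <= (C / l + (C / l) `^ P)%:E * mu A)%E.
Proof.
have [r [P [mr r1 rE]]] := bounded_exponent.
exists P => [|f A C l mf mA C0 l0 fC].
  by have /andP[/le_trans] := r1 0; apply.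
rewrite (rE f l mf).
have mind : measurable_fun [set: L] (fun x : L => (\1_A x : R)%:E).
  by apply/measurable_EFinP; exact: measurable_indic.
have t0 : 0 <= C / l by rewrite divr_ge0 // ltW.
have c0 : 0 <= C / l + (C / l) `^ P by rewrite addr_ge0 ?powR_ge0.
apply: (@le_trans _ _ (\int[mu]_(x in [set: L])
  ((C / l + (C / l) `^ P)%:E * (\1_A x)%:E))%E).
  apply: (@ge0_le_integral _ L R mu setT measurableT
    _ _ _ (measurable_density l mr mf) (measurable_funeM _ mind)).
    by move=> x _; rewrite lee_fin powR_ge0.
  move=> x _; rewrite -EFinM lee_fin; have /andP[r1x rPx] := r1 x.
  have rx0 : 0 < r x by exact: lt_le_trans r1x.
  have := fC x; rewrite indicE; case: (x \in A); rewrite ?mulr1 ?mulr0 => fx.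
    apply: (@le_trans _ _ ((C / l) `^ r x)).
      by rewrite ge0_ler_powR ?nnegrE ?divr_ge0 ?modulus_ge0 ?(ltW l0)
        ?(ltW rx0) // ler_pM2r // invr_gt0.
    have [t1|t1] := leP 1 (C / l).
      by apply: le_trans (ler_powR t1 rPx) _; rewrite lerDr.
    have [->|tn0] := eqVneq (C / l) 0; first
      by rewrite powR0 ?gt_eqF // add0r powR_ge0.
    apply: (@le_trans _ _ (C / l)); last by rewrite lerDl powR_ge0.
    by apply: ge1r_powR => //; rewrite lt0r tn0 t0 ltW.
  have -> : modulus (f x) = 0 by apply/eqP; rewrite eq_le fx modulus_ge0.
  by rewrite mul0r powR0 ?gt_eqF.
rewrite (ge0_integralZl mu measurableT mind) ?lee_fin //.
by rewrite (integral_indic mu measurableT mA) setIT.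
Qed.

(** Dominated convergence; the upper bound on the exponent turns finiteness of
    the modular at one scale into finiteness at every scale. *)
Lemma modular_tail f (A : nat -> set E) l (d : R) : cmeasurable f ->
  (forall j, measurable (A j : set L)) ->
  (forall x, \forall j \near \oo, ~ A j x) ->
  0 < l -> (modular p f l < +oo)%E -> 0 < d ->
  \forall j \near \oo, (modular p (mul_indic f (A j)) d <= 1)%E.
Proof.
move=> mf mA Ax l0 ffin d0; have [r [P [mr r1 rE]]] := bounded_exponent.
have mfl h l1 := @measurable_density R n r h l1 mr.
have mfA j : cmeasurable (mul_indic f (A j)) by exact: cmeasurable_mul_indic.
(* [F j <= G]: passing from scale [l] to [d] costs a factor [(l / d) ^ r] *)
pose c := Num.max 1 (l / d); have c1 : 1 <= c by rewrite /c le_max lexx.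
pose F j (x : L) := ((modulus (mul_indic f (A j) x) / d) `^ r x)%:E.
pose G (x : L) := ((c `^ P)%:E * ((modulus (f x) / l) `^ r x)%:E)%E.
have mG : measurable_fun [set: L] G := measurable_funeM _ (mfl f l mf).
have iG : mu.-integrable [set: L] G.
  apply/integrableP; split; first exact: mG.
  rewrite (eq_integral G); last first.
    by move=> x _; rewrite gee0_abs //; apply: mule_ge0;
      rewrite lee_fin powR_ge0.
  have cP0 : (0 <= (c `^ P)%:E)%E by rewrite lee_fin powR_ge0.
  rewrite (ge0_integralZl mu measurableT (mfl f l mf) _ cP0); last first.
    by move=> x _; rewrite lee_fin powR_ge0.
  by rewrite -(rE f l mf) lte_mul_pinfty.
have rpos x : 0 < r x by have /andP[? _] := r1 x; exact: lt_le_trans ltr01 _.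
have FG : {ae mu, forall x, forall j, [set: L] x -> (`|F j x| <= G x)%E}.
  apply: aeW => x j _; have -> : (`|F j x| = F j x)%E
    by rewrite gee0_abs // lee_fin powR_ge0.
  rewrite /F /G -EFinM lee_fin; have /andP[r1x rPx] := r1 x.
  apply: le_trans (ler_wpM2r (powR_ge0 _ _) (ler_powR c1 rPx)).
  rewrite -powRM ?divr_ge0 ?modulus_ge0 ?(ltW l0) // ?(le_trans ler01) //.
  rewrite ge0_ler_powR ?nnegrE ?divr_ge0 ?mulr_ge0 ?modulus_ge0 ?(ltW l0)
    ?(ltW d0) ?invr_ge0 ?(ltW l0) ?(ltW (rpos x)) //.
    exact: le_trans c1.
  apply: (@le_trans _ _ (l / d * (modulus (f x) / l))); last first.
    by rewrite ler_wpM2r ?divr_ge0 ?modulus_ge0 ?(ltW l0) // /c le_max lexx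
      orbT.
  have -> : l / d * (modulus (f x) / l) = modulus (f x) / d by field;
    rewrite !gt_eqF.
  rewrite ler_pM2r ?invr_gt0 // /mul_indic modulusM ler_piMr ?modulus_ge0 //.
  by rewrite indicE -(rmorph_nat (real_complex R)) modulus_real normr_nat lern1
    leq_b1.
have F0 : {ae mu, forall x, [set: L] x -> F j x @[j --> \oo] --> (0 : \bar R)}.
  apply: aeW => x _; apply: cvg_near_cst; apply: filterS (Ax x) => j nA.
  rewrite /F /mul_indic indicE memNset // mulr0 ComplexField.Normc.normc0 mul0r
    powR0 //.
  by rewrite gt_eqF.
have [_ _] := dominated_convergence (measurableT : measurable [set: L])
  (fun j => mfl _ d (mfA j)) (@measurable_cst _ _ L (\bar R) setT 0%E) F0 iG FG.
rewrite integral0 => /fine_cvgP[Ffin /cvgrPdist_le /(_ _ ltr01) Fle].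
near=> j; rewrite (rE _ d (mfA j)) -[X in (X <= _)%E]fineK; last by near: j.
rewrite lee_fin; apply: le_trans (ler_norm _) _; rewrite -normrN -sub0r;
  near: j.
exact: Fle.
Unshelve. all: by end_near. Qed.

Lemma luxemburg_ge0 f : (0 <= luxemburg p f)%E.
Proof. by apply: le_ereal_inf_tmp => _ [l [l0 _] <-]; rewrite lee_fin ltW. Qed.

Lemma luxemburg_le f l : 0 < l -> (modular p f l <= 1)%E ->
  (luxemburg p f <= l%:E)%E.
Proof. by move=> l0 fl; apply: ereal_inf_lbound; exists l. Qed.

Lemma luxemburg_lt f (a : \bar R) : (luxemburg p f < a)%E ->
  exists l, [/\ 0 < l, (l%:E < a)%E & (modular p f l <= 1)%E].
Proof. by move=> /ereal_inf_lt[_ [l [l0 fl] <-] la]; exists l. Qed.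

Lemma luxemburg_scale f g (t : R) : cmeasurable f -> cmeasurable g -> 0 < t ->
  (forall x, modulus (f x) <= t * modulus (g x)) ->
  (luxemburg p f <= t%:E * luxemburg p g)%E.
Proof.
move=> mf mg t0 fg; rewrite -lee_pdivrMl //.
apply: le_ereal_inf_tmp => _ [l [l0 gl] <-].
rewrite lee_pdivrMl // -EFinM; apply: luxemburg_le; first exact: mulr_gt0.
apply: le_trans gl; apply: modular_le => //; first exact: mulr_gt0.
move=> x; rewrite ler_pdivrMr ?mulr_gt0 //; apply: le_trans (fg x) _.
by rewrite le_eqVlt; apply/orP; left; apply/eqP; field; rewrite gt_eqF.
Qed.

Lemma luxemburg_mono f g : cmeasurable f -> cmeasurable g ->
  (forall x, modulus (f x) <= modulus (g x)) ->
    (luxemburg p f <= luxemburg p g)%E.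
Proof.
move=> mf mg fg; rewrite -[X in (_ <= X)%E]mul1e;
  apply: luxemburg_scale => // x.
by rewrite mul1r.
Qed.

End modular_theory.

(** * Sums over arbitrary index sets *)

Section finite_sums.
Variables (R : realType) (I : choiceType).
Implicit Types (a : I -> \bar R) (F : set I).

Lemma esum_le_card F : finite_set F -> exists N : nat, forall a (c : R),
  (forall i, F i -> (0 <= a i <= c%:E)%E) ->
  (\esum_(i in F) a i <= (N%:R * c)%:E)%E.
Proof.
move=> finF; exists (size (finmap.enum_fset (fset_set F))) => a c ac.
rewrite esum_fset //; last by move=> i; rewrite inE => /ac /andP[].
apply: (@le_trans _ _ (\sum_(i \in F) c%:E)%E).
  by apply: lee_fsum => // i /ac /andP[].
rewrite fsbig_finite // sumEFin big_const_seq count_predT iter_addr addr0.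
by rewrite lee_fin mulr_natl.
Qed.

Lemma esum_tail a (e : R) : (forall i, (0 <= a i)%E) ->
  (\esum_(i in [set: I]) a i < +oo)%E -> 0 < e ->
  exists2 F, finite_set F & (\esum_(i in ~` F) a i <= e%:E)%E.
Proof.
move=> a0 afin e0.
have sfin : \esum_(i in [set: I]) a i \is a fin_num.
  by rewrite ge0_fin_numE // esum_ge0.
have [_ [F [finF _] <-] aF] := ub_ereal_sup_adherent e0 sfin.
exists F => //.
have aFE : (\esum_(i in [set: I]) a i =
  \esum_(i in F) a i + \esum_(i in ~` F) a i)%E.
  by rewrite (esumID F) // !setTI.
move: aF; rewrite -/(esum setT a) -(esum_fset finF) // aFE.
have Ffin : \esum_(i in F) a i \is a fin_num.
  rewrite ge0_fin_numE ?esum_ge0 //; apply: le_lt_trans afin.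
  by rewrite aFE leeDl // esum_ge0.
have Cfin : \esum_(i in ~` F) a i \is a fin_num.
  rewrite ge0_fin_numE ?esum_ge0 //; apply: le_lt_trans afin.
  by rewrite aFE leeDr // esum_ge0.
rewrite -(fineK Ffin) -(fineK Cfin) -EFinD lte_fin lee_fin; lra.
Qed.

Lemma le_esum_term a i : (forall i, (0 <= a i)%E) ->
  (a i <= \esum_(i in [set: I]) a i)%E.
Proof.
move=> a0; apply: ereal_sup_ubound; exists [set i]; last by rewrite fsbig_set1.
by split => //; exact: finite_set1.
Qed.

Lemma near_finite_set F (P : I -> nat -> Prop) : finite_set F ->
  (forall i, F i -> \forall j \near \oo, P i j) ->
  \forall j \near \oo, forall i, F i -> P i j.
Proof.
move=> /finite_seqP[s ->] sP.
elim: s sP => [|i s IH] sP; first by apply: nearW => j i.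
have Hs : \forall j \near \oo, forall i0, [set` s] i0 -> P i0 j.
  by apply: IH => k ks; apply: sP; rewrite /= inE ks orbT.
have Hi : \forall j \near \oo, P i j by apply: sP; rewrite /= mem_head.
near=> j => k /=; rewrite inE => /orP[/eqP ->|ks]; first by near: j.
have : forall i0, [set` s] i0 -> P i0 j by near: j.
exact.
Unshelve. all: by end_near. Qed.

End finite_sums.

(** * Bounded functions with bounded support *)

Section bounded_support.
Variables (R : realType) (n : nat).
Local Notation E := 'rV[R]_n.+1.
Local Notation L := (lebesgue_space R n).
Local Notation mu := (@lebesgue_rV R n).
Local Notation modulus := (@ComplexField.Normc.normc R).
Implicit Types (f g h : E -> R[i]) (A : set E).

Definition centered_cube (m : nat) : set E :=
  box (const_mx (- m%:R), const_mx m%:R).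

Lemma centered_cubeP m x :
  centered_cube m x <-> forall j, - m%:R <= x ord0 j < m%:R.
Proof. by split => xm j; have := xm j; rewrite /= !mxE. Qed.

Lemma measurable_centered_cube m : measurable (centered_cube m : set L).
Proof. exact: measurable_box. Qed.

Lemma centered_cube_fin m : (mu (centered_cube m) < +oo)%E.
Proof. exact: le_lt_trans (lebesgue_box_le _) (ltry _). Qed.

Lemma sub_centered_cube m m' : (m <= m')%N ->
  centered_cube m `<=` centered_cube m'.
Proof.
move=> mm' x /centered_cubeP xm; apply/centered_cubeP => j.
have : (m%:R : R) <= m'%:R by rewrite ler_nat.
by have := xm j; lra.
Qed.

Lemma bounded_row (x : E) : exists m : nat, centered_cube m x.
Proof.
have [m Hm] : exists m : nat, forall j, `|x ord0 j| < m%:R.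
  have [b Hb] : exists b : 'I_n.+1 -> nat, forall j, `|x ord0 j| < (b j)%:R.
    apply: (fin_all_exists (P := fun j (b : nat) => `|x ord0 j| < b%:R)) => j;
      exists (Num.truncn `|x ord0 j|).+1.
    exact: Num.Theory.truncnS_gt.
  exists (\max_j b j) => j; apply: lt_le_trans (Hb j) _.
  by rewrite ler_nat; exact: leq_bigmax.
exists m; apply/centered_cubeP => j; have := Hm j;
  rewrite ltr_norml => /andP[+ ->].
by rewrite andbT => /ltW.
Qed.

(** A single parameter bounds both the values and the support, so that closure
    properties produce one witness. *)
Definition bounded_support f := cmeasurable f /\
  exists M : nat, forall x, modulus (f x) <= M%:R * \1_(centered_cube M) x.

Lemma bounded_supportD f g : bounded_support f -> bounded_support g ->
  bounded_support (fun x => f x + g x).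
Proof.
move=> [mf [M fM]] [mg [N gN]]; split; first exact: (cmeasurableD mf mg).
exists (M + N)%N => x; rewrite natrD mulrDl; apply: le_trans (modulusD _ _) _.
apply: lerD.
  apply: le_trans (fM x) _; rewrite ler_wpM2l // !indicE.
  have [xM|//] := boolP (x \in centered_cube M).
  by rewrite mem_set //; apply: (sub_centered_cube (leq_addr N M));
    rewrite inE in xM.
apply: le_trans (gN x) _; rewrite ler_wpM2l // !indicE.
have [xM|//] := boolP (x \in centered_cube N).
by rewrite mem_set //; apply: (sub_centered_cube (leq_addl M N));
  rewrite inE in xM.
Qed.

Lemma bounded_supportZ (z : R[i]) f : bounded_support f ->
  bounded_support (fun x => z * f x).
Proof.
move=> [mf [M fM]]; split; first exact: (cmeasurableZ z mf).
exists (maxn M (Num.truncn (modulus z * M%:R)).+1) => x; rewrite modulusM.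
have [xM|xM] := boolP (x \in centered_cube M); last first.
  have := fM x; rewrite indicE (negbTE xM) mulr0 => fx.
  have -> : modulus (f x) = 0 by apply/eqP; rewrite eq_le fx modulus_ge0.
  by rewrite mulr0 mulr_ge0.
apply: (@le_trans _ _ (modulus z * M%:R)).
  by rewrite ler_wpM2l ?modulus_ge0 //; have := fM x; rewrite indicE xM mulr1.
rewrite indicE mem_set ?mulr1; last first.
  by apply: (sub_centered_cube (leq_maxl _ _)); rewrite inE in xM.
apply: le_trans (ltW (Num.Theory.truncnS_gt _)) _.
by rewrite ler_nat leq_maxr.
Qed.

Lemma bounded_support0 : bounded_support (fun=> 0).
Proof.
split; first exact: cmeasurable_cst.
by exists 0%N => x; rewrite ComplexField.Normc.normc0 mul0r.
Qed.

Lemma bounded_support_sum (N : nat) (u : nat -> E -> R[i]) :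
  (forall k, bounded_support (u k)) ->
    bounded_support (fun x => \sum_(k < N) u k x).
Proof.
move=> bu; elim: N => [|N IH].
  have -> : (fun x => \sum_(k < 0) u k x) = (fun=> 0).
    by apply/funext => x; rewrite big_ord0.
  exact: bounded_support0.
have -> : (fun x => \sum_(k < N.+1) u k x) =
  (fun x => \sum_(k < N) u k x + u N x).
  by apply/funext => x; rewrite big_ord_recr.
exact: (bounded_supportD IH (bu N)).
Qed.

Lemma bounded_support_dilate (r : R) f : 0 < r -> bounded_support f ->
  bounded_support (fun x => f (r *: x)).
Proof.
move=> r0 [mf [M fM]]; split; first exact: (cmeasurable_dilate r0 mf).
exists (maxn M (Num.truncn (M%:R / r)).+1) => x.
have := fM (r *: x); rewrite !indicE.
have [xM|_] := boolP (r *: x \in centered_cube M); last first.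
  by rewrite mulr0 => /le_trans; apply; rewrite mulr_ge0.
rewrite mulr1 => /le_trans; apply.
rewrite mem_set ?mulr1 ?ler_nat ?leq_maxl //.
apply/(sub_centered_cube (leq_maxr _ _))/centered_cubeP => j.
rewrite inE in xM; have /centered_cubeP /(_ j) := xM;
  rewrite mxE => /andP[x1 x2].
have Mr : M%:R < r * (Num.truncn (M%:R / r)).+1%:R.
  by rewrite mulrC -ltr_pdivrMr // Num.Theory.truncnS_gt.
by rewrite -(ler_pM2l r0) -[X in _ && X](ltr_pM2l r0) mulrN; lra.
Qed.

Lemma bounded_support_St (alpha r : R) f : 0 < r -> bounded_support f ->
  bounded_support (St alpha r f).
Proof.
move=> r0 bf; apply: bounded_supportZ.
by apply: bounded_support_dilate => //; rewrite invr_gt0.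
Qed.

Lemma cmeasurable_St (alpha r : R) f : 0 < r -> cmeasurable f ->
  cmeasurable (St alpha r f).
Proof.
move=> r0 mf; apply: cmeasurableZ.
by apply: cmeasurable_dilate => //; rewrite invr_gt0.
Qed.

Definition truncation_set f (j : nat) : set E :=
  [set x | modulus (f x) <= j%:R] `&` centered_cube j.

Lemma measurable_truncation_set f j : cmeasurable f ->
  measurable (truncation_set f j : set L).
Proof.
move=> mf; apply: measurableI; last exact: measurable_centered_cube.
have := measurable_modulus mf measurableT (measurable_itv `]-oo, j%:R]).
by rewrite setTI; congr (measurable _); apply/seteqP; split => x;
  rewrite /= in_itv.
Qed.

Lemma bounded_support_truncation f j : cmeasurable f ->
  bounded_support (mul_indic f (truncation_set f j)).
Proof.
move=> mf; split;
  first exact: (cmeasurable_mul_indic mf (measurable_truncation_set j mf)).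
exists j => x; rewrite /mul_indic !indicE.
have [|_] := boolP (x \in truncation_set f j); last first.
  by rewrite mulr0 ComplexField.Normc.normc0 mulr_ge0.
by rewrite inE => -[fx xj]; rewrite mulr1 mem_set // mulr1.
Qed.

Lemma near_truncation_set f x : \forall j \near \oo,
  ~ (~` truncation_set f j) x.
Proof.
have [m xm] := bounded_row x.
exists (maxn m (Num.truncn (modulus (f x))).+1) => // j /=.
rewrite geq_max => /andP[mj fj] /=; apply; split;
  last exact: (sub_centered_cube mj).
by apply: le_trans (ltW (Num.Theory.truncnS_gt _)) _; rewrite ler_nat.
Qed.

End bounded_support.

(** * The amalgam norm *)

Section amalgam_norm.
Variables (R : realType) (n : nat).
Local Notation E := 'rV[R]_n.+1.
Local Notation L := (lebesgue_space R n).
Local Notation mu := (@lebesgue_rV R n).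
Local Notation modulus := (@ComplexField.Normc.normc R).
Variables (p : E -> \bar R) (q : R).
Hypotheses (hp : exponent_class p) (hq : 1 <= q).
Implicit Types (f g h b : E -> R[i]) (A : set E) (k : 'rV[int]_n.+1).

Let q0 : 0 < q. Proof. exact: lt_le_trans hq. Qed.

Lemma measurable_cube k : measurable (cube 1 k : set L).
Proof.
rewrite (_ : cube 1 k = box (\row_j (k ord0 j)%:~R,
  \row_j ((k ord0 j)%:~R + 1))).
  exact: measurable_box.
by apply/seteqP; split => x xk j; have := xk j; rewrite /= !mxE !mul1r.
Qed.

Lemma modulus_mul_indic_le f A x : modulus (mul_indic f A x) <= modulus (f x).
Proof.
rewrite /mul_indic indicE; case: (x \in A); first by rewrite mulr1.
by rewrite mulr0 ComplexField.Normc.normc0 modulus_ge0.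
Qed.

Lemma modulus_mul_indic f A x : modulus (mul_indic f A x) =
  modulus (f x) * \1_A x.
Proof.
rewrite /mul_indic !indicE; case: (x \in A); first by rewrite !mulr1.
by rewrite !mulr0 ComplexField.Normc.normc0.
Qed.

Lemma poweR_le (a b : \bar R) (r : R) : 0 <= r -> (0 <= a)%E -> (a <= b)%E ->
  (a `^ r <= b `^ r)%E.
Proof.
by move=> r0 a0 ab; apply: gt0_ler_poweR => //;
  rewrite in_itv /= ?leey ?andbT // (le_trans a0).
Qed.

Lemma amalgam_norm_mono f g : cmeasurable f -> cmeasurable g ->
  (forall x, modulus (f x) <= modulus (g x)) ->
  (amalgam_norm p q f <= amalgam_norm p q g)%E.
Proof.
move=> mf mg fg; apply: poweR_le; first by rewrite invr_ge0 ltW.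
  by apply: esum_ge0 => k _; exact: poweR_ge0.
apply: le_esum => k _; apply: poweR_le; [exact: ltW|exact: luxemburg_ge0|].
apply: (luxemburg_mono hp (cmeasurable_mul_indic mf (measurable_cube k))
  (cmeasurable_mul_indic mg (measurable_cube k))) => x.
by rewrite !modulus_mul_indic ler_wpM2r.
Qed.

(** The common shape of the two estimates of an amalgam norm below: finitely
    many cubes are controlled one by one through the modular, the others through
    the sum of the powers of their local norms. *)
Lemma amalgam_norm_le1 (F : set 'rV[int]_n.+1) : finite_set F ->
  exists2 e : R, 0 < e & forall h,
    (forall k, F k -> (modular p (mul_indic h (cube 1 k)) e <= 1)%E) ->
    (\esum_(k in ~` F) luxemburg p (mul_indic h (cube 1 k)) `^ q <=
      (2^-1)%:E)%E ->
    (amalgam_norm p q h <= 1)%E.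
Proof.
move=> finF; have [N NF] := @esum_le_card R _ F finF.
(* [N] terms, each at most [c], sum to at most one half *)
pose c : R := (N.+1%:R * 2)^-1; have c0 : 0 < c
  by rewrite invr_gt0 mulr_gt0 // ltr0n.
exists (c `^ q^-1) => [|h hF hC]; first exact: powR_gt0.
have sum1 : (\esum_(k in [set: 'rV[int]_n.+1]) luxemburg p
  (mul_indic h (cube 1 k)) `^ q <= 1)%E.
  rewrite (esumID F); last by move=> *; exact: poweR_ge0.
  rewrite !setTI; have -> : (1 = (2^-1)%:E + (2^-1)%:E :> \bar R)%E.
    by rewrite -EFinD; congr (_%:E); field.
  apply: leeD hC; apply: le_trans (NF _ c _) _.
    move=> k Fk; rewrite poweR_ge0 /=.
    have -> : c%:E = ((c `^ q^-1)%:E `^ q)%E.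
      by rewrite poweR_EFin -powRrM mulVf ?gt_eqF // powRr1 // ltW.
    apply: poweR_le; [exact: ltW|exact: luxemburg_ge0|].
    by apply: luxemburg_le; [exact: powR_gt0|exact: hF].
  rewrite lee_fin /c ler_pdivrMr; last by rewrite mulr_gt0 // ltr0n.
  have : (N%:R : R) <= N.+1%:R by rewrite ler_nat.
  by lra.
rewrite /amalgam_norm -[X in (_ <= X)%E](poweR1r q^-1); apply: poweR_le => //.
  by rewrite invr_ge0 ltW.
by apply: esum_ge0 => k _; exact: poweR_ge0.
Qed.

Lemma luxemburg0 f : (forall x, modulus (f x) = 0) -> cmeasurable f ->
  luxemburg p f = 0%E.
Proof.
move=> f0 mf; apply/eqP; rewrite eq_le luxemburg_ge0 andbT.
apply/lee_addgt0Pr => e e0; rewrite add0e; apply: luxemburg_le => //.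
have [P _ HP] := modular_bounded hp.
have := HP f set0 0 e mf measurable0 (lexx _) e0.
by rewrite measure0 mule0 => /(_ (fun x => _)) /le_trans -> // x;
  rewrite f0 mul0r.
Qed.

Lemma finite_cubes (m : nat) : finite_set
  [set k | exists2 x : E, cube 1 k x & centered_cube m x].
Proof.
(* each coordinate of such a [k] satisfies [- m - 1 <= k j < m] *)
pose G (g : {ffun 'I_n.+1 -> 'I_(m.+1 + m)}) : 'rV[int]_n.+1 :=
  \row_j ((g j)%:Z - m.+1%:Z).
apply: (@sub_finite_set _ _ (range G)); last exact: finite_image.
move=> k [x xk /centered_cubeP xm].
have H j : (- (m.+1%:Z) <= k ord0 j < m%:Z).
  have := xk j; have := xm j; rewrite !mul1r => /andP[? ?] /andP[? ?].
  apply/andP; split.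
    rewrite -ltzD1 -(ltr_int R) rmorphD rmorphN /= -!pmulrn -natr1; lra.
  by rewrite -(ltr_int R) -pmulrn; lra.
have [g Hg] : exists g : 'I_n.+1 -> 'I_(m.+1 + m), forall j, (g j)%:Z =
  k ord0 j + m.+1%:Z.
  apply: (fin_all_exists (P := fun j (i : 'I_(m.+1 + m)) => i%:Z =
    k ord0 j + m.+1%:Z)) => j.
  have Hn : (absz (k ord0 j + m.+1%:Z)%R < m.+1 + m)%N by have := H j; lia.
  by exists (Ordinal Hn) => /=; have := H j; lia.
exists [ffun j => g j] => //; apply/rowP => j; rewrite !mxE ffunE Hg.
by rewrite addrK.
Qed.

(** Unit cubes outside a finite family contribute nothing, so the threshold
    depends on the size of the support only. *)
Lemma amalgam_norm_supp (m : nat) : exists2 e : R, 0 < e & forall h,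
  cmeasurable h ->
  (forall x, ~ centered_cube m x -> modulus (h x) = 0) ->
  (modular p h e <= 1)%E -> (amalgam_norm p q h <= 1)%E.
Proof.
have [e e0 He] := amalgam_norm_le1 (finite_cubes m).
exists e => // h mh h0 hm; apply: He => [k _|].
  apply: le_trans hm; apply: (modular_le hp _ mh e0 e0).
    exact: (cmeasurable_mul_indic mh (measurable_cube k)).
  by move=> x; rewrite ler_pM2r ?invr_gt0 // modulus_mul_indic_le.
rewrite esum1 ?lee_fin ?invr_ge0 // => k nk.
suff -> : luxemburg p (mul_indic h (cube 1 k)) = 0%E
  by rewrite poweR0r // gt_eqF.
apply: luxemburg0 (cmeasurable_mul_indic mh (measurable_cube k)) => x.
rewrite modulus_mul_indic indicE; have [|_] := boolP (x \in cube 1 k); last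
  by rewrite mulr0.
rewrite inE => xk; rewrite h0 ?mul0r // => xm; apply: nk; by exists x.
Qed.

(** On each of the finitely many cubes that carry most of the norm of [f] the
    truncation error tends to zero by dominated convergence; on the others the
    error is at most the local norm of [f], which is small in sum. *)
Lemma amalgam_truncation f (e : R) : amalgam p q f -> 0 < e ->
  exists2 b, bounded_support b &
    (forall x, modulus (f x - b x) <= modulus (f x)) /\
    (amalgam_norm p q (fun x => (e^-1)%:C%C * (f x - b x))%R <= 1)%E.
Proof.
move=> [[mf _] fq] e0.
have a0 k : (0 <= luxemburg p (mul_indic f (cube 1 k)) `^ q)%E
  by exact: poweR_ge0.
have afin : (\esum_(k in [set: 'rV[int]_n.+1]) luxemburg p
  (mul_indic f (cube 1 k)) `^ q < +oo)%E.
  by apply: lty_poweRy fq; rewrite gt_eqF // invr_gt0.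
(* dividing by [e] multiplies the [q]-th powers by [e ^ - q] *)
have eta0 : 0 < e `^ q / 2 by rewrite divr_gt0 // powR_gt0.
have [F finF FC] := esum_tail a0 afin eta0.
have [t t0 Ht] := amalgam_norm_le1 finF.
have mfk k := cmeasurable_mul_indic mf (measurable_cube k).
have [j Hj] : exists j, forall k, F k ->
    (modular p (mul_indic (mul_indic f (cube 1 k)) (~` truncation_set f j))
      (e * t) <= 1)%E.
  suff : \forall j \near \oo, forall k, F k ->
    (modular p (mul_indic (mul_indic f (cube 1 k)) (~` truncation_set f j))
      (e * t) <= 1)%E.
    by case=> N _ HN; exists N; apply: HN => /=.
  apply: near_finite_set => // k _.
  have kfin : (luxemburg p (mul_indic f (cube 1 k)) < +oo)%E.
    apply: (@lty_poweRy _ _ q); first by rewrite gt_eqF.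
    apply: le_lt_trans afin; exact: (le_esum_term k a0).
  have [l [l0 _ fl]] := luxemburg_lt kfin.
  apply: (modular_tail hp (mfk k) _ (near_truncation_set f) l0
    (le_lt_trans fl (ltry _)) (mulr_gt0 e0 t0)).
  by move=> j; apply: measurableC; exact: measurable_truncation_set.
pose b := mul_indic f (truncation_set f j).
have bb : bounded_support b by exact: bounded_support_truncation.
have fbE x : f x - b x = mul_indic f (~` truncation_set f j) x.
  rewrite /b /mul_indic !indicE in_setC; case: (x \in truncation_set f j).
    by rewrite mulr1 mulr0 subrr.
  by rewrite mulr0 mulr1 subr0.
have mfb : cmeasurable (fun x => f x - b x) by exact: (cmeasurableB mf bb.1).
have meb := cmeasurableZ (e^-1)%:C%C mfb.
have mebE x : modulus ((e^-1)%:C%C * (f x - b x)) = e^-1 * modulus (f x - b x).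
  by rewrite modulusM modulus_real gtr0_norm // invr_gt0.
have fble x : modulus (f x - b x) <= modulus (f x)
  by rewrite fbE modulus_mul_indic_le.
exists b => //; split => //.
apply: Ht => [k Fk|].
  apply: le_trans (Hj k Fk); apply: (modular_le hp _ _ t0 (mulr_gt0 e0 t0))
    => [||x].
  - exact: (cmeasurable_mul_indic meb (measurable_cube k)).
  - by apply: (cmeasurable_mul_indic (mfk k)); apply: measurableC;
      exact: measurable_truncation_set.
  rewrite !modulus_mul_indic mebE fbE modulus_mul_indic le_eqVlt; apply/orP;
    left; apply/eqP.
  by field; rewrite !gt_eqF.
apply: (@le_trans _ _ (\esum_(k in ~` F)
  ((e^-1 `^ q)%:E * luxemburg p (mul_indic f (cube 1 k)) `^ q))%E).
  apply: le_esum => k _; rewrite -poweR_EFin -poweRM ?luxemburg_ge0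
    ?lee_fin ?invr_ge0 ?(ltW e0) //.
  apply: poweR_le; [exact: ltW|exact: luxemburg_ge0|].
  apply: (luxemburg_scale hp _ (mfk k)) => [||x].
  - exact: (cmeasurable_mul_indic meb (measurable_cube k)).
  - by rewrite invr_gt0.
  by rewrite !modulus_mul_indic mebE mulrA ler_wpM2r // ler_wpM2l ?fble
    // invr_ge0 (ltW e0).
have eq0 : 0 < e^-1 `^ q by rewrite powR_gt0 // invr_gt0.
rewrite ge_ereal_sup //= => _ [G [finG GF] <-].
rewrite -ge0_mule_fsumr; last by move=> *; exact: poweR_ge0.
apply: (@le_trans _ _ ((e^-1 `^ q)%:E * (e `^ q / 2)%:E)%E).
  rewrite lee_pmul2l //; apply: le_trans FC; apply: ereal_sup_ubound;
    by exists G.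
rewrite -EFinM lee_fin mulrA -powRM ?invr_ge0 ?(ltW e0) // mulVf ?gt_eqF
  // powR1.
by rewrite mul1r.
Qed.

End amalgam_norm.

(** * Rational step functions *)

Section step_functions.
Variables (R : realType) (n : nat).
Local Notation E := 'rV[R]_n.+1.
Local Notation L := (lebesgue_space R n).
Local Notation mu := (@lebesgue_rV R n).
Local Notation modulus := (@ComplexField.Normc.normc R).
Local Notation code :=
  (seq ((rat * rat) * seq ('rV[rat]_n.+1 * 'rV[rat]_n.+1))).
Implicit Types (f g h b : E -> R[i]) (A : set E) (s : code).

Definition ratc (a : rat * rat) : R[i] := (ratr a.1 +i* ratr a.2)%C.

Definition step s : E -> R[i] :=
  fun x => \sum_(t <- s) ratc t.1 * \1_(rat_figure t.2) x.

Lemma step_nil : step [::] = fun=> 0.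
Proof. by apply/funext => x; rewrite /step big_nil. Qed.

Lemma step_cons t s :
  step (t :: s) = fun x => ratc t.1 * \1_(rat_figure t.2) x + step s x.
Proof. by apply/funext => x; rewrite /step big_cons. Qed.

Lemma step_cat s s' x : step (s ++ s') x = step s x + step s' x.
Proof. by rewrite /step big_cat. Qed.

Lemma ratcM (a a' : rat * rat) :
  ratc (a.1 * a'.1 - a.2 * a'.2, a.1 * a'.2 + a.2 * a'.1) = ratc a * ratc a'.
Proof. by rewrite /ratc /= !rmorphD !rmorphN !rmorphM. Qed.

Lemma step_scale a s : exists s', forall x, step s' x = ratc a * step s x.
Proof.
exists [seq ((a.1 * t.1.1 - a.2 * t.1.2, a.1 * t.1.2 + a.2 * t.1.1), t.2) | t
  <- s] => x.
rewrite /step big_map mulr_sumr; apply: eq_bigr => t _ /=.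
by rewrite mulrA -ratcM.
Qed.

Lemma cmeasurable_step s : cmeasurable (step s).
Proof.
elim: s => [|t s IH]; first by rewrite step_nil; exact: cmeasurable_cst.
rewrite step_cons; apply: (cmeasurableD _ IH).
exact: (cmeasurableZ _ (cmeasurable_indic (measurable_rat_figure t.2))).
Qed.

Lemma step_bounded s : exists C : R, forall x, modulus (step s x) <= C.
Proof.
elim: s => [|t s [C HC]].
  by exists 0 => x; rewrite step_nil ComplexField.Normc.normc0.
exists (modulus (ratc t.1) + C) => x; rewrite step_cons.
apply: le_trans (modulusD _ _) _; apply: lerD => //.
rewrite indicE; case: (x \in _);
  rewrite ?mulr1 // mulr0 ComplexField.Normc.normc0.
exact: modulus_ge0.
Qed.

(** The cut keeps an approximant inside a cube that contains the support of the
    function it approximates, so that the error only involves finitely many unit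
    cubes. *)
Definition rational_steps : set (E -> R[i]) :=
  [set mul_indic (step c.2) (@centered_cube R n c.1) | c in [set: nat * code]].

Lemma countable_rational_steps : countable rational_steps.
Proof. by apply: card_le_trans (card_image_le _ _) _; exact: countableP. Qed.

Lemma bounded_support_rational_step g : rational_steps g -> bounded_support g.
Proof.
move=> [[m s] _ <-] /=; have mS := cmeasurable_step s.
split; first exact: (cmeasurable_mul_indic mS (measurable_centered_cube _)).
have [C HC] := step_bounded s.
exists (maxn m (Num.truncn C).+1) => x; rewrite modulus_mul_indic !indicE.
have [xm|_] := boolP (x \in @centered_cube R n m); last
  by rewrite mulr0 mulr_ge0.
rewrite inE in xm; rewrite mem_set;
  last exact: (sub_centered_cube (leq_maxl _ _)).
rewrite !mulr1; apply: le_trans (HC x) _.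
apply: le_trans (ltW (Num.Theory.truncnS_gt _)) _.
by rewrite ler_nat leq_maxr.
Qed.

Variable p : E -> \bar R.
Hypothesis hp : exponent_class p.
Variable m : nat.
Local Notation Q := (@centered_cube R n m).

Let mQ : measurable (Q : set L) := @measurable_centered_cube R n m.

(** The functions in the closure of the step functions for the norm of [Q]; the
    closure is a vector space over the Gaussian rationals, closed under uniform
    limits, and contains the indicators. *)
Definition approximable b := cmeasurable b /\
  forall e : R, 0 < e -> exists s,
    (modular p (mul_indic (fun x => b x - step s x)%R Q) e <= 1)%E.

Lemma mul_indicD f g A : mul_indic (fun x => f x + g x) A =
  (fun x => mul_indic f A x + mul_indic g A x).
Proof. by apply/funext => x; rewrite /mul_indic mulrDl. Qed.

Lemma approximableD f g : approximable f -> approximable g ->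
  approximable (fun x => f x + g x).
Proof.
move=> [mf Hf] [mg Hg]; split; first exact: (cmeasurableD mf mg).
move=> e e0; have e20 : 0 < e / 2 by rewrite divr_gt0.
have [s Hs] := Hf _ e20; have [s' Hs'] := Hg _ e20; exists (s ++ s').
have -> : (fun x => f x + g x - step (s ++ s') x) =
    (fun x => (f x - step s x) + (g x - step s' x)).
  by apply/funext => x; rewrite step_cat; ring.
rewrite mul_indicD [e](splitr e).
apply: (modularD hp _ _ e20 e20 Hs Hs').
  exact: (cmeasurable_mul_indic (cmeasurableB mf (cmeasurable_step s)) mQ).
exact: (cmeasurable_mul_indic (cmeasurableB mg (cmeasurable_step s')) mQ).
Qed.

Lemma approximable_scale a f : approximable f ->
  approximable (fun x => ratc a * f x).
Proof.
move=> [mf Hf]; split; first exact: (cmeasurableZ _ mf).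
move=> e e0; have M0 : 0 < modulus (ratc a) + 1
  by rewrite ltr_wpDl ?modulus_ge0.
have [s Hs] := Hf _ (divr_gt0 e0 M0); have [s' Hs'] := step_scale a s;
  exists s'.
have -> : (fun x => ratc a * f x - step s' x) =
  (fun x => ratc a * (f x - step s x)).
  by apply/funext => x; rewrite Hs' mulrBr.
have mfs := cmeasurableB mf (cmeasurable_step s).
apply: le_trans Hs; apply: (modular_le hp _ _ e0 (divr_gt0 e0 M0)) => [||x].
- exact: (cmeasurable_mul_indic (cmeasurableZ _ mfs) mQ).
- exact: (cmeasurable_mul_indic mfs mQ).
rewrite !modulus_mul_indic modulusM invf_div mulrA.
rewrite ler_pM2r ?invr_gt0 //= [leRHS]mulrC mulrA ler_wpM2r //.
by rewrite ler_wpM2r ?modulus_ge0 // lerDl.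
Qed.

Lemma approximable_indic A : measurable (A : set L) -> approximable (\1_A).
Proof.
move=> mA; split; first exact: cmeasurable_indic.
move=> e e0; have [P P1 HP] := modular_bounded hp.
pose c : R := 1 / e + (1 / e) `^ P.
have c0 : 0 < c by rewrite ltr_pwDl ?powR_ge0 // divr_gt0.
have mAQ : measurable (A `&` Q : set L) by exact: measurableI.
have fAQ : (mu (A `&` Q) < +oo)%E.
  apply: le_lt_trans (@centered_cube_fin R n m); apply: le_measure;
    rewrite ?inE //.
have ci0 : 0 < c^-1 by rewrite invr_gt0.
have [F HF] := rat_figure_approx mAQ fAQ ci0.
have mF := @measurable_rat_figure R n F.
exists [:: ((1, 0), F)].
set D := (X in (mu X <= _)%E) in HF.
have mD : measurable (D : set L) by apply: measurableU; exact: measurableD.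
have mh : cmeasurable (mul_indic (fun x => \1_A x - step [:: ((1, 0), F)] x) Q).
  apply: (cmeasurable_mul_indic _ mQ).
  exact: (cmeasurableB (cmeasurable_indic mA) (cmeasurable_step _)).
apply: le_trans (HP _ D 1 e mh mD ler01 e0 _) _ => [x|].
  rewrite mul1r modulus_mul_indic step_cons step_nil addr0 /=.
  have -> : ratc (1, 0) = 1 by rewrite /ratc /= rmorph1 rmorph0.
  rewrite mul1r !indicE.
  have [xQ|_] := boolP (x \in Q); last by rewrite mulr0.
  rewrite mulr1.
  have Dx (B : Prop) : B -> (B -> D x) -> (1 : R) <= (x \in D)%:R.
    by move=> b /(_ b) xD; rewrite mem_set.
  have [xA|xA] := boolP (x \in A); have [xF|xF] := boolP (x \in rat_figure F).
  - by rewrite subrr ComplexField.Normc.normc0.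
  - rewrite subr0 ComplexField.Normc.normc1 mem_set //; left.
    by rewrite !inE in xA xQ; move/negP: xF; rewrite inE.
  - rewrite sub0r modulusN ComplexField.Normc.normc1 mem_set //; right.
    split; first by rewrite inE in xF.
    by move=> [Ax _]; move/negP: xA; rewrite inE.
  - by rewrite subrr ComplexField.Normc.normc0.
rewrite -/c; apply: (@le_trans _ _ (c%:E * (c^-1)%:E)%E).
  by apply: lee_wpmul2l HF; rewrite lee_fin ltW.
by rewrite -EFinM divff // gt_eqF.
Qed.

Lemma modular_uniform (e : R) : 0 < e -> exists2 t : R, 0 < t & forall h,
  cmeasurable h ->
  (forall x, modulus (h x) <= t) -> (modular p (mul_indic h Q) e <= 1)%E.
Proof.
move=> e0; have [P P1 HP] := modular_bounded hp.
have Qf : mu Q \is a fin_num by rewrite ge0_fin_numE // centered_cube_fin.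
pose v := fine (mu Q); have v0 : 0 <= v by rewrite fine_ge0.
(* as [t <= 1], [t + t ^ P <= 2 t], and [2 t v <= 1] *)
pose t := (v *+ 2 + 1)^-1; have t0 : 0 < t
  by rewrite invr_gt0 ltr_wpDl // mulrn_wge0.
have t1 : t <= 1 by rewrite invf_le1 ?lerDr ?mulrn_wge0 // ltr_wpDl
  // mulrn_wge0.
exists (t * e) => [|h mh ht]; first exact: mulr_gt0.
have te0 : 0 <= t * e by rewrite mulr_ge0 // ltW.
apply: le_trans (HP _ Q (t * e) e (cmeasurable_mul_indic mh mQ) mQ te0 e0 _)
  _ => [x|].
  by rewrite modulus_mul_indic ler_wpM2r.
rewrite mulfK ?gt_eqF // -(fineK Qf) -EFinM lee_fin -/v.
have tP : t `^ P <= t by apply: ge1r_powR => //; rewrite t0.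
apply: (@le_trans _ _ ((t + t) * v)); first by rewrite ler_wpM2r // lerD2l.
have : t * (v *+ 2 + 1) = 1 by rewrite mulVf // gt_eqF // ltr_wpDl
  // mulrn_wge0.
by rewrite mulr2n; nra.
Qed.

Lemma approximable_closed b : cmeasurable b ->
  (forall e : R, 0 < e -> exists2 a, approximable a & forall x,
    modulus (b x - a x) <= e) ->
  approximable b.
Proof.
move=> mb Hb; split => // e e0; have e20 : 0 < e / 2 by rewrite divr_gt0.
have [t t0 Ht] := modular_uniform e20; have [a [ma Ha] ba] := Hb t t0.
have [s Hs] := Ha _ e20; exists s.
have -> : (fun x => b x - step s x) = (fun x => (b x - a x) + (a x - step s x)).
  by apply/funext => x; ring.
rewrite mul_indicD [e](splitr e).
have mba := cmeasurableB mb ma.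
apply: (modularD hp _ _ e20 e20 (Ht _ mba ba) Hs).
  exact: (cmeasurable_mul_indic mba mQ).
exact: (cmeasurable_mul_indic (cmeasurableB ma (cmeasurable_step s)) mQ).
Qed.

(** Binary expansion of the values of [a]: each digit is an indicator. *)
Lemma dyadic_approximable (M : nat) (a : E -> R) : measurable_fun [set: L]
  (a : L -> R) ->
  (forall x, 0 <= a x <= M%:R) -> forall k, exists c : E -> R,
  [/\ measurable_fun [set: L] (c : L -> R), approximable (fun x => (c x)%:C%C)
    & forall x, 0 <= a x - c x <= M%:R / 2 ^+ k].
Proof.
move=> ma aM; elim => [|k [c [mc cA cle]]].
  exists (fun=> 0); split; [exact: measurable_cst| |by move=> x;
    rewrite subr0 expr0 divr1].
  have := approximable_indic (measurable0 : measurable (set0 : set L)).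
  by congr approximable; apply/funext => x; rewrite indic0 rmorph0.
pose w : rat := M%:R / 2 ^+ k.+1.
have wE : ratr w = M%:R / 2 ^+ k.+1 :> R.
  by rewrite /w rmorphM fmorphV rmorphXn /= !ratr_nat.
pose A : set E := [set x | ratr w <= a x - c x].
have mA : measurable (A : set L).
  have := (measurable_funB ma mc) measurableT
    _ (measurable_itv `[(ratr w : R), +oo[).
  rewrite setTI; congr (measurable _).
  by apply/seteqP; split => x; rewrite /A /= in_itv /= andbT.
exists (fun x => c x + ratr w * \1_A x); split.
- by apply: (measurable_funD mc);
    exact: (measurable_funM (measurable_cst _) (measurable_indic mA)).
- have := approximableD cA (approximable_scale (w, 0) (approximable_indic mA)).
  congr approximable; apply/funext => x;
    rewrite !indicE rmorphD rmorphM /= rmorph_nat.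
  by congr (_ + _ * _); rewrite /ratc /= rmorph0.
move=> x; have /andP[c1 c2] := cle x.
have wk : M%:R / 2 ^+ k = ratr w + ratr w :> R.
  by rewrite wE exprS; field; rewrite expf_neq0.
rewrite -wE; rewrite wk in c2; rewrite indicE.
have [xA|xA] := boolP (x \in A); rewrite ?mulr1 ?mulr0.
  by rewrite inE /A /= in xA; apply/andP; split; lra.
have : a x - c x < ratr w by rewrite ltNge; apply: contra xA => xA; rewrite inE.
by move=> ?; apply/andP; split; lra.
Qed.

Lemma approximable_real (M : nat) (a : E -> R) : measurable_fun [set: L]
  (a : L -> R) ->
  (forall x, `|a x| <= M%:R) -> approximable (fun x => (a x)%:C%C).
Proof.
move=> ma aM.
have ma' : measurable_fun [set: L] (fun x : L => a x + M%:R).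
  exact: (measurable_funD ma (measurable_cst _)).
have aM' x : 0 <= a x + M%:R <= (M + M)%:R.
  by have := aM x; rewrite ler_norml natrD => /andP[? ?]; apply/andP; split;
    lra.
(* [a + M] is nonnegative, and the constant [M] is itself approximable *)
have pos : approximable (fun x => (a x + M%:R)%:C%C).
  apply: approximable_closed; first exact: cmeasurable_real.
  move=> e e0; pose k := Num.truncn ((M + M)%:R / e).
  have [c [mc cA cle]] := dyadic_approximable ma' aM' k.+1;
    exists (fun x => (c x)%:C%C) => // x.
  have /andP[c1 c2] := cle x.
  rewrite -rmorphB modulus_real ger0_norm //; apply: le_trans c2 _.
  rewrite ler_pdivrMr ?exprn_gt0 // mulrC -ler_pdivrMr //.
  apply: le_trans (ltW (Num.Theory.truncnS_gt _)) _.
  by rewrite -/k -natrX ler_nat ltnW // ltn_expl.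
have := approximableD pos (approximable_scale (- M%:R, 0)
  (approximable_indic (measurableT : measurable (setT : set L)))).
congr approximable; apply/funext => x; rewrite indicT mulr1.
have -> : ratc (- M%:R, 0) = (- M%:R)%:C%C.
  by rewrite /ratc /= rmorph0 rmorphN /= ratr_nat.
by rewrite -rmorphD addrK.
Qed.

Lemma approximable_bounded (M : nat) b : cmeasurable b ->
  (forall x, modulus (b x) <= M%:R) -> approximable b.
Proof.
move=> mb bM.
have reM x : `|complex.Re (b x)| <= M%:R.
  apply: le_trans (bM x); case: (b x) => u v /=.
  by rewrite -sqrtr_sqr ler_wsqrtr // lerDl sqr_ge0.
have imM x : `|complex.Im (b x)| <= M%:R.
  apply: le_trans (bM x); case: (b x) => u v /=.
  by rewrite -sqrtr_sqr ler_wsqrtr // lerDr sqr_ge0.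
have := approximableD (approximable_real mb.1 reM)
  (approximable_scale (0, 1) (approximable_real mb.2 imM)).
congr approximable; apply/funext => x; rewrite /ratc /= rmorph0 rmorph1.
by case: (b x) => u v; apply/eqP; rewrite eq_complex /=; apply/andP; split;
  apply/eqP; ring.
Qed.

End step_functions.

(** * Density in the amalgam norm *)

Section density.
Variables (R : realType) (n : nat).
Local Notation E := 'rV[R]_n.+1.
Local Notation modulus := (@ComplexField.Normc.normc R).
Variables (p : E -> \bar R) (q : R).
Hypotheses (hp : exponent_class p) (hq : 1 <= q).
Implicit Types (b g : E -> R[i]).

Lemma rational_steps_dense b (e : R) : bounded_support b -> 0 < e ->
  exists2 g, rational_steps g &
    (amalgam_norm p q (fun x => (e^-1)%:C%C * (b x - g x))%R <= 1)%E.
Proof.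
move=> [mb [M bM]] e0.
have [t t0 Ht] := amalgam_norm_supp hp hq M.
have bM' x : modulus (b x) <= M%:R.
  apply: le_trans (bM x) _; rewrite indicE; case: (x \in _);
    rewrite ?mulr1 // mulr0.
  exact: ler0n.
have [_ /(_ _ (mulr_gt0 e0 t0)) [s Hs]] := approximable_bounded hp M mb bM'.
pose g := mul_indic (step s) (@centered_cube R n M).
have gS : rational_steps g by exists (M, s).
have mg : cmeasurable g := (bounded_support_rational_step gS).1.
have mQ := @measurable_centered_cube R n M.
have bQ x : b x = mul_indic b (@centered_cube R n M) x.
  rewrite /mul_indic; have := bM x; rewrite !indicE; case: (x \in _); first
    by rewrite !mulr1.
  rewrite mulr0 => bx; rewrite mulr0; apply: ComplexField.Normc.eq0_normc.
  by apply/eqP; rewrite eq_le bx modulus_ge0.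
have bgE x : b x - g x = mul_indic (fun x => b x - step s x)
  (@centered_cube R n M) x.
  by rewrite bQ /g /mul_indic mulrBl.
have mbg := cmeasurableZ (e^-1)%:C%C (cmeasurableB mb mg).
have ebg x : modulus ((e^-1)%:C%C * (b x - g x)) = e^-1 * modulus (b x - g x).
  by rewrite modulusM modulus_real gtr0_norm // invr_gt0.
exists g => //; apply: (Ht _ mbg) => [x xQ|].
  rewrite ebg bgE modulus_mul_indic indicE memNset // !mulr0; done.
apply: le_trans Hs; apply: (modular_le hp mbg _ t0 (mulr_gt0 e0 t0)) => [|x].
  exact: (cmeasurable_mul_indic (cmeasurableB mb (cmeasurable_step R s)) mQ).
rewrite ebg bgE le_eqVlt; apply/orP; left; apply/eqP; field.
by rewrite !gt_eqF.
Qed.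

Lemma bounded_support_modular b : bounded_support b ->
  exists2 l : R, 0 < l & (modular p b l <= 1)%E.
Proof.
move=> [mb [M bM]]; have [P P1 HP] := modular_bounded hp.
have mQ := @measurable_centered_cube R n M.
have Qf : lebesgue_rV (@centered_cube R n M) \is a fin_num.
  by rewrite ge0_fin_numE // centered_cube_fin.
pose v := fine (lebesgue_rV (@centered_cube R n M)); have v0 : 0 <= v
  by rewrite fine_ge0.
pose l := (M%:R + 1) * (v * 2 + 1); have w0 : 0 < v * 2 + 1
  by rewrite ltr_wpDl // mulr_ge0.
have l0 : 0 < l by rewrite mulr_gt0 // ltr_wpDl.
exists l => //; apply: le_trans (HP _ _ M%:R l mb mQ (ler0n _ _) l0 bM) _.
rewrite -(fineK Qf) -EFinM lee_fin -/v.
pose t := M%:R / l; have t0 : 0 <= t by rewrite divr_ge0 // ltW.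
have tw : t * (v * 2 + 1) <= 1.
  have -> : t * (v * 2 + 1) = M%:R / (M%:R + 1).
    have M0 : 0 < M%:R + 1 :> R by rewrite ltr_wpDl.
    by rewrite /t /l; field; rewrite !gt_eqF.
  by rewrite ler_pdivrMr ?mul1r ?lerDl // ltr_wpDl.
have t1 : t <= 1.
  apply: le_trans tw; rewrite ler_peMr // lerDr mulr_ge0 //.
have tP : t `^ P <= t.
  have [->|tn] := eqVneq t 0; first
    by rewrite powR0 // gt_eqF // (lt_le_trans ltr01).
  by apply: ge1r_powR => //; rewrite lt0r tn t0.
apply: (@le_trans _ _ ((t + t) * v)); first by rewrite ler_wpM2r // lerD2l.
by move: tw; nra.
Qed.

Lemma bounded_support_Lvar_loc b : bounded_support b -> Lvar_loc p b.
Proof.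
move=> bb; have mb := bb.1; split; [exact: mb|] => K cK.
have mbK := cmeasurable_mul_indic mb (compact_measurable_rV cK).
split; [exact: mbK|]; have [l l0 bl] := bounded_support_modular bb.
apply: le_lt_trans (ltry l); apply: luxemburg_le => //; apply: le_trans bl.
apply: (modular_le hp mbK mb l0 l0) => x.
by rewrite ler_pM2r ?invr_gt0 // modulus_mul_indic_le.
Qed.

Lemma bounded_support_amalgam b : bounded_support b ->
  exists2 c : R, 0 < c & (amalgam_norm p q (fun x => (c^-1)%:C%C * b x)%R <=
    1)%E.
Proof.
move=> bb; have [mb [M bM]] := bb; have [l l0 bl] := bounded_support_modular bb.
have [t t0 Ht] := amalgam_norm_supp hp hq M.
have c0 : 0 < l / t by rewrite divr_gt0.
have mcb := cmeasurableZ ((l / t)^-1)%:C%C mb.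
have cbE x : modulus (((l / t)^-1)%:C%C * b x) = (l / t)^-1 * modulus (b x).
  by rewrite modulusM modulus_real gtr0_norm // invr_gt0.
exists (l / t) => //; apply: (Ht _ mcb) => [x xQ|].
  have := bM x; rewrite indicE memNset // mulr0 => bx.
  by rewrite cbE; apply/eqP; rewrite mulf_eq0 [X in _ || X]eq_le bx modulus_ge0
    orbT.
apply: le_trans bl; apply: (modular_le hp mcb mb t0 l0) => x.
rewrite cbE le_eqVlt; apply/orP; left; apply/eqP; field.
by rewrite !gt_eqF.
Qed.

Lemma Lvar_loc_le f g (C : R) : cmeasurable f -> Lvar_loc p g -> 0 < C ->
  (forall x, modulus (f x) <= C * modulus (g x)) -> Lvar_loc p f.
Proof.
move=> mf [mg gK] C0 fg; split; [exact: mf|] => K cK; have [mgK gfin] :=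
  gK K cK.
have mfK := cmeasurable_mul_indic mf (compact_measurable_rV cK).
split; [exact: mfK|]; have [l [l0 _ gl]] := luxemburg_lt gfin.
apply: le_lt_trans (ltry (C * l)); apply: luxemburg_le; first exact: mulr_gt0.
apply: le_trans gl; apply: (modular_le hp mfK mgK (mulr_gt0 C0 l0) l0) => x.
rewrite !modulus_mul_indic ler_pdivrMr ?mulr_gt0 //.
have -> : modulus (g x) * \1_K x / l * (C * l) = C * modulus (g x) * \1_K x.
  by field; rewrite gt_eqF.
by rewrite ler_wpM2r.
Qed.

Lemma Lvar_locD f g : Lvar_loc p f -> Lvar_loc p g ->
  Lvar_loc p (fun x => f x + g x).
Proof.
move=> [mf fK] [mg gK]; split; first exact: (cmeasurableD mf mg).
move=> K cK; have [mfK ffin] := fK K cK; have [mgK gfin] := gK K cK.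
have [l [l0 _ fl]] := luxemburg_lt ffin; have [l' [l'0 _ gl']] :=
  luxemburg_lt gfin.
rewrite mul_indicD; split; first exact: (cmeasurableD mfK mgK).
apply: le_lt_trans (ltry (l + l')); apply: luxemburg_le; first exact: addr_gt0.
exact: (modularD hp mfK mgK l0 l'0 fl gl').
Qed.

End density.

(** * Decompositions *)

Lemma cvge0_shift (R : realType) (u v : nat -> \bar R) (M N : nat) :
  (forall k, u (k + N)%N = v (k + M)%N) ->
  v k @[k --> \oo] --> (0 : \bar R) -> u k @[k --> \oo] --> (0 : \bar R).
Proof.
move=> uv v0.
have : (fun k => v (k + M)%N) k @[k --> \oo] --> (0 : \bar R).
  by have := v0; rewrite -(cvg_shiftn M).
by under eq_fun do rewrite -uv; rewrite (cvg_shiftn N).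
Qed.

Section decompositions.
Variables (R : realType) (n : nat).
Local Notation E := 'rV[R]_n.+1.
Local Notation modulus := (@ComplexField.Normc.normc R).
Variables (p : E -> \bar R) (q alpha : R).
Hypotheses (hp : exponent_class p) (hq : 1 <= q).
Implicit Types (f g h b u : E -> R[i]) (c : nat -> R[i]) (rhos : nat -> R)
  (fn bn : nat -> E -> R[i]).

Let q0 : 0 < q. Proof. exact: lt_le_trans hq. Qed.

Lemma amalgam_unit f : Lvar_loc p f -> (amalgam_norm p q f <= 1)%E ->
  amalgam p q f /\ (amalgam_norm p q f <= 1)%E.
Proof. by move=> fl f1; split;
  [split; [exact: fl|exact: le_lt_trans f1 (ltry _)]|]. Qed.

Lemma cmeasurable_sum (N : nat) fn : (forall k, cmeasurable (fn k)) ->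
  cmeasurable (fun x => \sum_(k < N) fn k x).
Proof.
move=> mfn; elim: N => [|N IH].
  have -> : (fun x => \sum_(k < 0) fn k x) = (fun=> 0).
    by apply/funext => x; rewrite big_ord0.
  exact: cmeasurable_cst.
have -> : (fun x => \sum_(k < N.+1) fn k x) =
  (fun x => \sum_(k < N) fn k x + fn N x).
  by apply/funext => x; rewrite big_ord_recr.
exact: (cmeasurableD IH (mfn N)).
Qed.

Lemma StM (rho : R) u f x : 0 < rho ->
  St alpha rho (fun y => u (rho *: y) * f y) x = u x * St alpha rho f x.
Proof.
move=> r0; rewrite /St scalerA divff ?gt_eqF // scale1r.
by rewrite mulrCA.
Qed.

Lemma StZB (rho : R) (z : R[i]) f b x :
  St alpha rho (fun y => z * (f y - b y)) x =
    z * (St alpha rho f x - St alpha rho b x).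
Proof. by rewrite /St mulrCA mulrBr. Qed.

Lemma St1 f : St alpha 1 f = f.
Proof. by apply/funext => x; rewrite /St powR1 mul1r invr1 scale1r. Qed.

(** Multiplication by a function bounded by one commutes with the dilations, up
    to dilating the multiplier, and increases no norm. *)
Lemma h_decomposition_mul u f c rhos fn : cmeasurable u ->
  (forall x, modulus (u x) <= 1) -> cmeasurable f ->
  h_decomposition p q alpha f c rhos fn ->
  h_decomposition p q alpha (fun x => u x * f x) c rhos
    (fun k x => u (rhos k *: x) * fn k x).
Proof.
move=> mu u1 mf [r0 fnA cS fS].
have mfn k : cmeasurable (fn k) by have [[[]]] := fnA k.
have muk k := cmeasurable_dilate (r0 k) mu.
have mufn k := cmeasurableM (muk k) (mfn k).
have ule (z w : R[i]) : modulus z <= 1 -> modulus (z * w) <= modulus w.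
  by move=> z1; rewrite modulusM ler_piMl ?modulus_ge0.
split; [exact: r0| |exact: cS|].
  move=> k; have [[fnL _] fn1] := fnA k; apply: amalgam_unit.
    by apply: (Lvar_loc_le hp (mufn k) fnL ltr01) => x; rewrite mul1r ule.
  by apply: le_trans fn1; apply: (amalgam_norm_mono hp hq (mufn k) (mfn k))
    => x; rewrite ule.
move=> K cK; have mK := compact_measurable_rV cK.
pose T N x := f x - \sum_(k < N) c k * St alpha (rhos k) (fn k) x.
have mT N : cmeasurable (T N).
  apply: (cmeasurableB mf);
    apply: (cmeasurable_sum N (fn :=
    fun k x => c k * St alpha (rhos k) (fn k) x)) => k.
  exact: (cmeasurableZ _ (cmeasurable_St alpha (r0 k) (mfn k))).
have TE N : (fun x => u x * f x - \sum_(k < N) c k * St alpha (rhos k)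
    (fun y => u (rhos k *: y) * fn k y) x) = (fun x => u x * T N x).
  apply/funext => x; rewrite /T mulrBr mulr_sumr; congr (_ - _).
  by apply: eq_bigr => k _; rewrite StM // mulrCA.
apply: (@squeeze_cvge _ _ _ _ (cst 0%E)
  _ (fun N => luxemburg p (mul_indic (T N) K))).
- apply: nearW => N; rewrite luxemburg_ge0 TE /=.
  apply: (luxemburg_mono hp) => [||x].
  + exact: (cmeasurable_mul_indic (cmeasurableM mu (mT N)) mK).
  + exact: (cmeasurable_mul_indic (mT N) mK).
  by rewrite !modulus_mul_indic ler_wpM2r ?ule.
- exact: cvg_cst.
- exact: fS K cK.
Qed.

Definition scons T (a : T) (v : nat -> T) : nat -> T :=
  fun k => if k is k'.+1 then v k' else a.

Lemma nneseries_scons (t : R) (z : R[i]) c : modulus z = t ->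
  (\sum_(0 <= k <oo) (modulus (scons z c k))%:E =
    t%:E + \sum_(0 <= k <oo) (modulus (c k))%:E)%E.
Proof.
move=> zt; rewrite (nneseries_split 0 1); last by move=> k _;
  rewrite lee_fin modulus_ge0.
rewrite add0n big_nat1 /= zt -nneseries_addn; last by move=> k;
  rewrite lee_fin modulus_ge0.
by congr (_ + _)%E; apply: eq_eseriesr => k _; rewrite addn1.
Qed.

(** A function in the amalgam is an atom of dilation ratio one; a bound [t] of
    its norm becomes a coefficient. *)
Lemma h_decomposition_cons f b (t : R) c rhos fn : 0 < t ->
  Lvar_loc p (fun x => (t^-1)%:C%C * b x) ->
  (amalgam_norm p q (fun x => (t^-1)%:C%C * b x)%R <= 1)%E ->
  h_decomposition p q alpha f c rhos fn ->
  h_decomposition p q alpha (fun x => f x + b x)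
    (scons t%:C%C c) (scons 1 rhos) (scons (fun x => (t^-1)%:C%C * b x) fn).
Proof.
move=> t0 bL b1 [r0 fnA cS fS]; split.
- by case=> [|k] /=.
- by case=> [|k] /=; [exact: amalgam_unit|exact: fnA].
- rewrite (@nneseries_scons t); last by rewrite modulus_real gtr0_norm.
  by rewrite lte_add_pinfty // ltry.
move=> K cK; apply: (cvge0_shift (N := 1) (M := 0) _ (fS K cK)) => N.
rewrite addn0 addn1; congr (luxemburg p (mul_indic _ K)).
apply/funext => x; rewrite big_ord_recl /= St1 mulrA -rmorphM divff ?gt_eqF
  // rmorph1 mul1r.
by rewrite opprD addrA addrK.
Qed.

Definition damped_coefs (N : nat) (e : R) c : nat -> R[i] :=
  fun k => if (k < N)%N then e%:C%C * c k else c k.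

Lemma damped_coefs_sum N e c : 0 < e ->
  (\sum_(0 <= k <oo) (modulus (damped_coefs N e c k))%:E <=
   e%:E * \sum_(0 <= k <oo) (modulus (c k))%:E + \sum_(N <= k <oo)
     (modulus (c k))%:E)%E.
Proof.
move=> e0; rewrite (nneseries_split 0 N); last by move=> k _;
  rewrite lee_fin modulus_ge0.
rewrite add0n; apply: leeD.
  rewrite -nneseriesZl; last by move=> k _; rewrite lee_fin modulus_ge0.
  apply: le_trans (nneseries_lim_ge N _); last first.
    by move=> k _ _; rewrite -EFinM lee_fin mulr_ge0 ?modulus_ge0 ?(ltW e0).
  rewrite !big_nat; apply: lee_sum => k /andP[_ kN].
  by rewrite /damped_coefs kN modulusM modulus_real gtr0_norm // EFinM.
rewrite le_eqVlt; apply/orP; left; apply/eqP; congr (limn _); apply/funext => M.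
by apply: eq_big_nat => k /andP[Nk _]; rewrite /damped_coefs ltnNge Nk.
Qed.

(** Subtracting approximations of the first [N] atoms leaves a decomposition
    whose first [N] coefficients have been multiplied by [e]. *)
Lemma h_decomposition_replace f c rhos fn bn (N : nat) (e : R) : 0 < e ->
  h_decomposition p q alpha f c rhos fn ->
  (forall k, cmeasurable (bn k)) ->
  (forall k x, modulus (fn k x - bn k x) <= modulus (fn k x)) ->
  (forall k, (amalgam_norm p q (fun x => (e^-1)%:C%C * (fn k x - bn k x))%R <=
    1)%E) ->
  h_decomposition p q alpha
    (fun x => f x - \sum_(k < N) c k * St alpha (rhos k) (bn k) x)
    (damped_coefs N e c) rhos
    (fun k => if (k < N)%N then fun x => (e^-1)%:C%C * (fn k x - bn k x) else
      fn k).
Proof.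
move=> e0 [r0 fnA cS fS] mbn bnle bn1.
have ei0 : 0 < e^-1 by rewrite invr_gt0.
split; [exact: r0| | |].
- move=> k; case: ltnP => kN; last exact: fnA.
  have [[fnL _] _] := fnA k; apply: amalgam_unit; last exact: bn1.
  apply: (Lvar_loc_le hp _ fnL ei0) => [|x].
    exact: (cmeasurableZ _ (cmeasurableB fnL.1 (mbn k))).
  by rewrite modulusM modulus_real gtr0_norm // ler_wpM2l ?(ltW ei0).
- apply: le_lt_trans (damped_coefs_sum N c e0) _.
  rewrite lte_add_pinfty //.
    by rewrite lte_mul_pinfty // lee_fin ltW.
  apply: le_lt_trans cS; rewrite [leRHS](nneseries_split 0 N); last first.
    by move=> k _; rewrite lee_fin modulus_ge0.
  by rewrite add0n leeDr // sume_ge0 // => k _; rewrite lee_fin modulus_ge0.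
move=> K cK; apply: (cvge0_shift (N := N) (M := N) _ (fS K cK)) => M;
  congr (luxemburg p (mul_indic _ K)).
apply/funext => x; rewrite -addrA -opprD; congr (_ - _).
rewrite addnC !big_split_ord /= addrA; congr (_ + _).
  rewrite -big_split /=; apply: eq_bigr => k _.
  rewrite /damped_coefs ltn_ord StZB.
  by rewrite mulrACA -rmorphM divff ?gt_eqF // rmorph1 mul1r mulrBr addrC subrK.
by apply: eq_bigr => k _; rewrite /damped_coefs ltnNge leq_addr.
Qed.

Lemma bounded_support_Hspace b : bounded_support b -> Hspace p q alpha b.
Proof.
move=> bb; split; first exact: (bounded_support_Lvar_loc hp bb).
have h0 : h_decomposition p q alpha (fun=> 0) (fun=> 0) (fun=> 1)
  (fun _ _ => 0).
  have b0 := bounded_support0 R n.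
  split; [by []| | |].
  - move=> k; apply: amalgam_unit;
      first exact: (bounded_support_Lvar_loc hp b0).
    have [t t0] := bounded_support_amalgam hp hq b0.
    by have -> : (fun=> (t^-1)%:C%C * 0) = (fun=> 0) :> (E -> R[i])
      by apply/funext => x; rewrite mulr0.
  - by rewrite eseries0 ?ltry // => k _ _; rewrite ComplexField.Normc.normc0.
  move=> K cK; apply: cvg_near_cst; apply: nearW => N;
    apply: (luxemburg0 hp) => [x|].
    by rewrite modulus_mul_indic big1 ?subr0 ?ComplexField.Normc.normc0 ?mul0r.
  apply: (cmeasurable_mul_indic _ (compact_measurable_rV cK)).
  have -> : (fun x : E => 0 - \sum_(k < N) 0 * St alpha 1 (fun=> 0) x) =
    (fun=> 0).
    by apply/funext => x; rewrite big1 ?subr0 // => k _; rewrite mul0r.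
  exact: cmeasurable_cst.
have [t t0 bt] := bounded_support_amalgam hp hq bb.
have btL := bounded_support_Lvar_loc hp (bounded_supportZ (t^-1)%:C%C bb).
have := h_decomposition_cons t0 btL bt h0.
have -> : (fun x => 0 + b x) = b by apply/funext => x; rewrite add0r.
by move=> hb; eexists; eexists; eexists; exact: hb.
Qed.

(** The norm is defined through the modulus of [h], which is [phase h * h]. *)
Lemma Hnorm_le_decomposition h c rhos fn : Lvar_loc p h ->
  h_decomposition p q alpha h c rhos fn ->
  (Hnorm p q alpha h <= \sum_(0 <= k <oo) (modulus (c k))%:E)%E.
Proof.
move=> hL hd; have mh := hL.1.
apply: ereal_inf_lbound; exists c, rhos,
  (fun k x => phase h (rhos k *: x) * fn k x).
have -> : (fun x => (modulus (h x))%:C%C) = (fun x => phase h x * h x).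
  by apply/funext => x; rewrite phaseM.
split; [|exact: (h_decomposition_mul (cmeasurable_phase mh) (phase_le1 h) mh
  hd)|by []].
apply: (Lvar_loc_le hp (cmeasurableM (cmeasurable_phase mh) mh) hL ltr01) => x.
by rewrite mul1r phaseM modulus_real ger0_norm ?modulus_ge0.
Qed.

(** The error has three parts, at most [e / 4] each: the atom [B - g], the first
    [N] coefficients after damping by [d], and the tail of the coefficients. *)
Lemma rational_steps_dense_Hspace f (e : R) : Hspace p q alpha f -> 0 < e ->
  exists2 g, rational_steps g &
    (Hnorm p q alpha (fun x => f x - g x)%R < e%:E)%E.
Proof.
move=> [fL [c [rhos [fn fd]]]] e0; have [r0 fnA cS fS] := fd.
pose S := (\sum_(0 <= k <oo) (modulus (c k))%:E)%E.
have c0 k : (0 <= (modulus (c k))%:E)%E by rewrite lee_fin modulus_ge0.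
have S0 : (0 <= S)%E by exact: nneseries_ge0.
have Sfin : S \is a fin_num by rewrite ge0_fin_numE.
have e40 : 0 < e / 4 by rewrite divr_gt0.
(* damping all the coefficients by [d] leaves a sum [d * S < e / 4] *)
pose d := e / 4 / (fine S + 1).
have s10 : 0 < fine S + 1 by rewrite ltr_wpDl ?fine_ge0.
have d0 : 0 < d by rewrite divr_gt0.
have [N tN] := nneseries_tail_small c0 cS e40.
have /choice[bn Hbn] k : exists b, [/\ bounded_support b,
    forall x, modulus (fn k x - b x) <= modulus (fn k x)
  & (amalgam_norm p q (fun x => (d^-1)%:C%C * (fn k x - b x))%R <= 1)%E].
  by have [b bb [ble b1]] := amalgam_truncation hp hq (fnA k).1 d0; exists b;
    split.
have bbn k : bounded_support (bn k) by have [] := Hbn k.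
pose B x := \sum_(k < N) c k * St alpha (rhos k) (bn k) x.
have bB : bounded_support B.
  apply: (bounded_support_sum N (u :=
    fun k x => c k * St alpha (rhos k) (bn k) x)) => k.
  exact: (bounded_supportZ _ (bounded_support_St alpha (r0 k) (bbn k))).
have [g gD gB] := rational_steps_dense hp hq bB e40.
have bg := bounded_support_rational_step gD.
have bmg : bounded_support (fun x => (-1) * g x) := bounded_supportZ (-1) bg.
have bBg : bounded_support (fun x => ((e / 4)^-1)%:C%C * (B x - g x)).
  apply: bounded_supportZ; have := bounded_supportD bB bmg.
  by under eq_fun do rewrite mulN1r.
have hR := h_decomposition_replace N d0 fd (fun k => (bbn k).1)
  (fun k => let: And3 _ h _ := Hbn k in h)
    (fun k => let: And3 _ _ h := Hbn k in h).
have hC := h_decomposition_cons e40 (bounded_support_Lvar_loc hp bBg) gB hR.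
have fgE : (fun x => f x - B x + (B x - g x)) = (fun x => f x - g x).
  by apply/funext => x; rewrite addrA subrK.
rewrite fgE in hC.
have fgL : Lvar_loc p (fun x => f x - g x).
  have := Lvar_locD hp fL (bounded_support_Lvar_loc hp bmg).
  by under eq_fun do rewrite mulN1r.
exists g => //; apply: le_lt_trans (Hnorm_le_decomposition fgL hC) _.
rewrite (@nneseries_scons (e / 4)); last by rewrite modulus_real gtr0_norm.
apply: (@le_lt_trans _ _ ((e / 4)%:E + (d%:E * S + (e / 4)%:E))%E).
  apply: leeD => //; apply: le_trans (damped_coefs_sum N c d0) _.
  by apply: leeD.
rewrite -(fineK Sfin) -EFinM -!EFinD lte_fin.
have : d * (fine S + 1) = e / 4 by rewrite /d divfK // gt_eqF.
by have := d0; lra.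
Qed.

End decompositions.

Theorem theorem4p21 (R : realType) (n : nat)
    (p : 'rV[R]_n.+1 -> \bar R) (q alpha : R)
    (hp : exponent_class p)
    (hq : 1 <= q) (hqa : q <= alpha)
    (hap : forall x, (alpha%:E <= p x)%E) :
  separable_for (Hnorm p q alpha) (Hspace p q alpha).
Proof.
exists (@rational_steps R n); split.
- exact: countable_rational_steps.
- by move=> g /bounded_support_rational_step; exact: bounded_support_Hspace.
- by move=> f fH e e0; exact: (rational_steps_dense_Hspace hp hq fH e0).
Qed.
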